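(* Let $n\ge 0$ be an integer, $\varphi\in\mathcal C^n(\mathbb R,(0,\infty))$, let $k:\mathbb R^2\to\mathbb R$, $p,\eta:\mathbb R\to\mathbb R$, $f:\mathbb R^2\to[0,\infty)$, and $$Tu(t)=p(t)+\int_{-\infty}^{\infty}k(t,s)\,\eta(s)\,f(s,u(s))\,\mathrm ds .$$ Let $\alpha:\widetilde{\mathcal C}^n_\varphi\to\mathbb R$ be a continuous functional such that, for all $u,v\in\widetilde{\mathcal C}^n_\varphi$ and $\lambda\ge0$, $\alpha(u+v)\ge\alpha(u)+\alpha(v)$, $\alpha(\lambda u)\ge\lambda\alpha(u)$, and [$\alpha(u)\ge0$ and $\alpha(-u)\ge0$] implies $u\equiv0$. Put $K_\alpha=\{u\in\widetilde{\mathcal C}^n_\varphi:\alpha(u)\ge0\}$. Assume: (C1) $\frac{\partial^j k}{\partial t^j}(t,\cdot)\,\eta(\cdot)\in L^1(\mathbb R)$ for every $t\in\mathbb R$, $j=0,\dots,n$; $k(\cdot,s)\eta(s)\in\widetilde{\mathcal C}^n_\varphi$ for every $s\in\mathbb R$; and for every $j=0,\dots,n$ there is a measurable function $\omega_j$ such that for every $\varepsilon>0$ there is $\delta>0$ such that $|t_1-t_2|<\delta$ implies $$\left|\frac{\partial^j(k/\varphi)}{\partial t^j}(t_1,s)\eta(s)-\frac{\partial^j(k/\varphi)}{\partial t^j}(t_2,s)\eta(s)\right|<\varepsilon\,\omega_j(s)\quad\text{for a.e. } s\in\mathbb R.$$ (C2) $f(\cdot,y)$ is measurable for each fixed $y\in\mathbb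 R$, $f(t,\cdot)$ is continuous for a.a. $t\in\mathbb R$, and for each $r>0$ there exists $\phi_r\in L^1(\mathbb R)$ such that $f(t,y\varphi(t))\le\phi_r(t)$ for all $y\in[-r,r]$ and a.a. $t\in\mathbb R$. (C3) For every $r>0$, $j=0,\dots,n$ and $l=0,\dots,j$, the function $t\mapsto\frac{\partial^{j-l}}{\partial t^{j-l}}\frac1\varphi(t)\int_{-\infty}^\infty\left|\frac{\partial^l k}{\partial t^l}(t,s)\eta(s)\right|\phi_r(s)\,\mathrm ds$ belongs to $L^\infty(\mathbb R)$ and $\omega_j\phi_r\in L^1(\mathbb R)$. Moreover, with $z^\pm(s)=\lim_{t\to\pm\infty}\frac{k(t,s)\eta(s)}{\varphi(t)}$ and $M(s)=\sup_{t\in\mathbb R}\left|\frac{k(t,s)\eta(s)}{\varphi(t)}\right|$, we have $|z^\pm|\phi_r,\ M\phi_r\in L^1(\mathbb R)$ for all $r>0$. (C4) $p\in\widetilde{\mathcal C}^n_\varphi$. (C5) $\alpha(k(\cdot,s)\eta(s))\ge0$ for a.e. $s\in\mathbb R$ and $\alpha(p)\ge0$. (C6) $\alpha(Tu)\ge\int_{-\infty}^\infty\alpha(k(\cdot,s)\eta(s))f(s,u(s))\,\mathrm ds+\alpha(p)$ for all $u\in K_\alpha$. Then $T$ maps $(\widetilde{\mathcal C}^n_\varphi,\|\cdot\|_\varphi)$ to itself, is continuous and compact (it maps bounded sets to relatively compact sets), and maps $K_\alpha$ to $K_\alpha$.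
   Context: $\overline{\mathbb R}=[-\infty,\infty]$ carries its usual compact (order) topology. $\mathcal C^n(\overline{\mathbb R},\mathbb R)$ is the space of continuous $g:\overline{\mathbb R}\to\mathbb R$ with $g|_{\mathbb R}\in\mathcal C^n(\mathbb R,\mathbb R)$ and such that $\lim_{t\to\pm\infty}g^{(j)}(t)$ exist in $\mathbb R$ for $j=0,\dots,n$; its norm is $\|g\|_{(n)}=\sup\{\|g^{(j)}\|_\infty: j=0,\dots,n\}$. For $\varphi\in\mathcal C^n(\mathbb R,(0,\infty))$, $\widetilde{\mathcal C}^n_\varphi$ is the Banach space of all $u\in\mathcal C^n(\mathbb R,\mathbb R)$ for which there is a (necessarily unique) $\tilde u\in\mathcal C^n(\overline{\mathbb R},\mathbb R)$ with $u=\varphi\,\tilde u|_{\mathbb R}$, with norm $\|u\|_\varphi=\|\tilde u\|_{(n)}$. The expression $\frac{\partial^j(k/\varphi)}{\partial t^j}(t,s)$ denotes the $j$-th $t$-derivative of $k(t,s)/\varphi(t)$. *)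

(* Defs.v *)
From HB Require Import structures.
From mathcomp Require Import all_boot all_order all_algebra.
From mathcomp Require Import all_classical all_reals all_analysis.
From mathcomp Require Import measurable_realfun.

Set Implicit Arguments.
Unset Strict Implicit.
Unset Printing Implicit Defensive.

Import Order.TTheory GRing.Theory Num.Theory.
Import numFieldNormedType.Exports.

Local Open Scope ring_scope.
Local Open Scope classical_set_scope.

Section function_spaces.
Context {R : realType}.
Implicit Types (n j : nat) (h : R -> R) (g : \bar R -> R).

Definition Cn n h :=
  (forall j, (j < n)%N -> forall x, derivable (derive1n j h) x 1) /\
  continuous (derive1n n h).

Definition Cbar n g :=
  [/\ continuous g, Cn n (g \o EFin) &
      forall j, (j <= n)%N ->
        cvg (derive1n j (g \o EFin) t @[t --> +oo]) /\
        cvg (derive1n j (g \o EFin) t @[t --> -oo])].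

Definition sup_norm h : R := sup (range (fun t => `|h t|)).

(* The suprema run over the real line: since g^(j) has limits at both ends,
   the two points at infinity do not change them. *)
Definition Cbar_norm n g : R :=
  \big[Num.max/0]_(j < n.+1) sup_norm (derive1n j (g \o EFin)).

Record weight n := Weight {
  weight_fun :> R -> R ;
  weight_Cn : Cn n weight_fun ;
  weight_gt0 : forall t, 0 < weight_fun t }.

Definition factor_of n (phi : R -> R) (u : R -> R) : set (\bar R -> R) :=
  [set g | Cbar n g /\ forall t, u t = phi t * g t%:E].

Definition in_Ctilde n (phi : R -> R) : set (R -> R) :=
  [set u | Cn n u /\ factor_of n phi u !=set0].

(* unique as soon as phi has no zero, see [tilde_eq] *)
Definition tilde n (phi u : R -> R) : \bar R -> R :=
  xget (cst 0) (factor_of n phi u).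

End function_spaces.
Arguments weight R n : clear implicits.

Section Cn_theory.
Context {R : realType}.
Implicit Types (n j : nat) (h : R -> R) (g : \bar R -> R).

Lemma Cn_derivable n h j x :
  Cn n h -> (j < n)%N -> derivable (derive1n j h) x 1.
Proof. by move=> [H _] jn; exact: H. Qed.

Lemma Cn_continuous n h j : Cn n h -> (j <= n)%N -> continuous (derive1n j h).
Proof.
move=> [H c]; rewrite leq_eqVlt => /predU1P[->//|jn] x.
by apply/differentiable_continuous/derivable1_diffP; exact: H.
Qed.

Lemma derive1n_linear n (a : R) h1 h2 j : Cn n h1 -> Cn n h2 -> (j <= n)%N ->
  derive1n j (fun t => a * h1 t + h2 t) =
  (fun t => a * derive1n j h1 t + derive1n j h2 t).
Proof.
move=> C1 C2; elim: j => [//|j IH] jn.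
rewrite !derive1nS IH ?(ltnW jn)//; apply/funext => t.
have d1 := @Cn_derivable n h1 j t C1 jn; have d2 := @Cn_derivable n h2 j t C2 jn.
rewrite !derive1E.
rewrite (_ : (fun _ => _) = (a \*: derive1n j h1 : R -> R) + derive1n j h2)//.
by rewrite deriveD// ?deriveZ//; exact: derivableZ.
Qed.

Lemma Cn_linear n (a : R) h1 h2 : Cn n h1 -> Cn n h2 ->
  Cn n (fun t => a * h1 t + h2 t).
Proof.
move=> C1 C2; split=> [j jn x|].
  rewrite (derive1n_linear a C1 C2 (ltnW jn)).
  rewrite (_ : (fun _ => _) = (a \*: derive1n j h1 : R -> R) + derive1n j h2)//.
  apply: derivableD; last exact: Cn_derivable C2 jn.
  by apply: derivableZ; exact: Cn_derivable C1 jn.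
rewrite (derive1n_linear a C1 C2 (leqnn n)) => x.
apply: cvgD; last exact: Cn_continuous C2 (leqnn n) x.
by apply: cvgM; [exact: cvg_cst|exact: Cn_continuous C1 (leqnn n) x].
Qed.

Lemma Cbar_linear n (a : R) g1 g2 : Cbar n g1 -> Cbar n g2 ->
  Cbar n (fun x => a * g1 x + g2 x).
Proof.
move=> [c1 C1 l1] [c2 C2 l2].
split=> [x||j jn].
- apply: cvgD; last exact: c2.
  by apply: cvgM; [exact: cvg_cst|exact: c1].
- exact: Cn_linear C1 C2.
- have -> : derive1n j ((fun x => a * g1 x + g2 x) \o EFin) =
     (fun t => a * derive1n j (g1 \o EFin) t + derive1n j (g2 \o EFin) t).
    exact: derive1n_linear C1 C2 jn.
  have [? ?] := l1 _ jn; have [? ?] := l2 _ jn.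
  by split; (apply: is_cvgD => //; apply: is_cvgM => //; exact: is_cvg_cst).
Qed.

Lemma derive1n_cst0 j : derive1n j (fun=> 0 : R) = (fun=> 0 : R).
Proof.
elim: j => [//|j IH]; rewrite derive1nS IH.
by apply/funext => t; exact: (@derive1_cst R R 0 t).
Qed.

Lemma Cn0 n : Cn n (fun=> 0 : R).
Proof.
split=> [j _ x|]; rewrite derive1n_cst0; first exact: derivable_cst.
by move=> x; exact: cvg_cst.
Qed.

Lemma Cbar0 n : Cbar n (fun=> 0 : R).
Proof.
split=> [x||j _]; first exact: cvg_cst; first exact: Cn0.
by rewrite (_ : _ \o _ = fun=> 0)// derive1n_cst0; split; exact: is_cvg_cst.
Qed.

Lemma cvg_Cbar_pinfty g : continuous g -> g t%:E @[t --> +oo%R] --> g +oo%E.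
Proof.
move=> cg; apply: (@cvg_comp _ _ _ EFin g _ (nbhs +oo%E)); last exact: cg.
by move=> A [M [Mr MA]]; exists M; split => // x Mx; apply: MA; rewrite lte_fin.
Qed.

Lemma cvg_Cbar_ninfty g : continuous g -> g t%:E @[t --> -oo%R] --> g -oo%E.
Proof.
move=> cg; apply: (@cvg_comp _ _ _ EFin g _ (nbhs -oo%E)); last exact: cg.
by move=> A [M [Mr MA]]; exists M; split => // x Mx; apply: MA; rewrite lte_fin.
Qed.

Lemma Cbar_eq g1 g2 : continuous g1 -> continuous g2 ->
  (forall t : R, g1 t%:E = g2 t%:E) -> g1 = g2.
Proof.
move=> c1 c2 e; have E : (fun t : R => g1 t%:E) = (fun t => g2 t%:E).
  exact/funext.
apply/funext => -[r||]; first exact: e.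
- have h1 := cvg_Cbar_pinfty c1; have := cvg_Cbar_pinfty c2.
  by rewrite -E => h2; exact: (cvg_unique _ h1 h2).
- have h1 := cvg_Cbar_ninfty c1; have := cvg_Cbar_ninfty c2.
  by rewrite -E => h2; exact: (cvg_unique _ h1 h2).
Qed.

Lemma has_sup_cvg_infty h : continuous h ->
  cvg (h t @[t --> +oo]) -> cvg (h t @[t --> -oo]) ->
  has_sup (range (fun t => `|h t|)).
Proof.
move=> ch cp cm; split; first by exists `|h 0|, 0.
have [M [Mr HM]] := cvg_bounded _ _ cp.
have [N [Nr HN]] := cvg_bounded _ _ cm.
have [A [_ HA]] := HM _ (ltr_pwDr ltr01 (lexx M)).
have [B [_ HB]] := HN _ (ltr_pwDr ltr01 (lexx N)).
have BA : Num.min (B - 1) (A + 1) <= Num.max (B - 1) (A + 1).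
  by rewrite ge_min !le_max !lexx.
have [c _ Hc] := @EVT_max R (fun t => `|h t|) _ _ BA
  (continuous_subspaceT (fun x => cvg_norm (ch x))).
exists (Num.max (Num.max (M + 1) (N + 1)) `|h c|) => _ [t _ <-].
rewrite !le_max.
have [At|tA] := ltP A t; first by rewrite (HA _ At).
have [tB|Bt] := ltP t B; first by rewrite (HB _ tB) orbT.
rewrite (Hc t) ?orbT// in_itv/= ge_min le_max; apply/andP; split.
  by apply/orP; left; apply: le_trans Bt; rewrite gerBl.
by apply/orP; right; apply: (le_trans tA); rewrite lerDl.
Qed.

Lemma sup_norm_ge0 h : 0 <= sup_norm h.
Proof.
have [hs|hs] := pselect (has_sup (range (fun t => `|h t|))); last first.
  by rewrite /sup_norm sup_out.
by apply: (le_trans (normr_ge0 (h 0))); apply: ub_le_sup; [case: hs|exists 0].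
Qed.

Lemma Cbar_has_sup n g j : Cbar n g -> (j <= n)%N ->
  has_sup (range (fun t => `|derive1n j (g \o EFin) t|)).
Proof.
move=> [_ C l] jn; have [lp lm] := l _ jn.
by apply: has_sup_cvg_infty => //; exact: Cn_continuous C jn.
Qed.

Lemma Cbar_norm_ge n g j t : Cbar n g -> (j <= n)%N ->
  `|derive1n j (g \o EFin) t| <= Cbar_norm n g.
Proof.
move=> Cg jn; rewrite /Cbar_norm.
have := @le_bigmax _ _ 'I_n.+1 0
  (fun i : 'I_n.+1 => sup_norm (derive1n i (g \o EFin)))
  (Ordinal (jn : (j < n.+1)%N)).
apply: le_trans => /=; apply: ub_le_sup; last by exists t.
by case: (Cbar_has_sup Cg jn).
Qed.

Lemma Cbar_norm_le n g (M : R) : 0 <= M ->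
  (forall j t, (j <= n)%N -> `|derive1n j (g \o EFin) t| <= M) ->
  Cbar_norm n g <= M.
Proof.
move=> M0 H; apply: bigmax_le => // i _; apply: ge_sup.
  by exists `|derive1n i (g \o EFin) 0|, 0.
by move=> _ [t _ <-]; apply: H; rewrite -ltnS.
Qed.

Lemma Cbar_norm_ge0 n g : 0 <= Cbar_norm n g.
Proof. by rewrite /Cbar_norm; exact: bigmax_ge_id. Qed.

End Cn_theory.

Section Ctilde.
Context {R : realType} {n : nat} (phi : weight R n).

Lemma factor_tilde u : in_Ctilde n phi u -> factor_of n phi u (tilde n phi u).
Proof. by move=> [_ [g gu]]; exact: xgetI gu. Qed.

Lemma tilde_eq u g : factor_of n phi u g -> tilde n phi u = g.
Proof.
move=> ug; have [[c1 _ _] e1] : factor_of n phi u (tilde n phi u).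
  exact: xgetI ug.
case: ug => -[c2 _ _] e2; apply: Cbar_eq => // t.
by apply: (mulfI (lt0r_neq0 (weight_gt0 phi t))); rewrite -e1 -e2.
Qed.

Lemma factor_linear a u v gu gv : factor_of n phi u gu -> factor_of n phi v gv ->
  factor_of n phi (fun t => a * u t + v t) (fun x => a * gu x + gv x).
Proof.
move=> [Cu eu] [Cv ev]; split; first exact: Cbar_linear.
by move=> t; rewrite eu ev mulrDr mulrCA.
Qed.

Definition Ctilde_pred : {pred R -> R} := mem (in_Ctilde n phi).

Record Ctilde := MkCtilde {
  Ctilde_fun :> R -> R ;
  _ : Ctilde_fun \in Ctilde_pred }.

HB.instance Definition _ := [isSub for Ctilde_fun].
HB.instance Definition _ := [Choice of Ctilde by <:].

Fact Ctilde_submod_closed : submod_closed Ctilde_pred.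
Proof.
split=> [|a u v]; rewrite !inE.
  split; first exact: Cn0.
  by exists (fun=> 0); split => [|t]; [exact: Cbar0|rewrite mulr0].
move=> [Cu [gu uP]] [Cv [gv vP]]; split; first exact: Cn_linear Cu Cv.
by eexists; exact: factor_linear uP vP.
Qed.

HB.instance Definition _ :=
  GRing.isSubmodClosed.Build R (R -> R) Ctilde_pred Ctilde_submod_closed.
HB.instance Definition _ := [SubChoice_isSubLmodule of Ctilde by <:].

Definition Ctilde_norm (u : Ctilde) : R := Cbar_norm n (tilde n phi u).

Lemma CtildeP (u : Ctilde) : factor_of n phi u (tilde n phi u).
Proof. by apply: factor_tilde; case: u => u /=; rewrite inE. Qed.

Lemma tilde_linear a (u v : Ctilde) : tilde n phi (a *: u + v : Ctilde) =
  (fun x => a * tilde n phi u x + tilde n phi v x).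
Proof. by apply: tilde_eq; apply: factor_linear; exact: CtildeP. Qed.

Lemma derive1n_tilde_linear a (u v : Ctilde) j : (j <= n)%N ->
  derive1n j (tilde n phi (a *: u + v : Ctilde) \o EFin) =
  (fun t => a * derive1n j (tilde n phi u \o EFin) t
            + derive1n j (tilde n phi v \o EFin) t).
Proof.
move=> jn; rewrite tilde_linear.
have [[_ C1 _] _] := CtildeP u; have [[_ C2 _] _] := CtildeP v.
exact: derive1n_linear C1 C2 jn.
Qed.

Fact Ctilde_normD (u v : Ctilde) :
  Ctilde_norm (u + v) <= Ctilde_norm u + Ctilde_norm v.
Proof.
have [Cu _] := CtildeP u; have [Cv _] := CtildeP v.
apply: Cbar_norm_le; first by rewrite addr_ge0// Cbar_norm_ge0.
move=> j t jn; rewrite -[u + v]/(u + v : Ctilde) -(scale1r u).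
rewrite derive1n_tilde_linear// scale1r mul1r.
by apply: (le_trans (ler_normD _ _)); apply: lerD; exact: Cbar_norm_ge.
Qed.

Fact tilde0 : tilde n phi (0 : Ctilde) = fun=> 0.
Proof.
by apply: tilde_eq; split => [|t]; [exact: Cbar0|rewrite mulr0].
Qed.

Let Ctilde_normZ_le a (u : Ctilde) :
  Ctilde_norm (a *: u) <= `|a| * Ctilde_norm u.
Proof.
have [Cu _] := CtildeP u.
apply: Cbar_norm_le; first by rewrite mulr_ge0// Cbar_norm_ge0.
move=> j t jn; rewrite -(addr0 (a *: u)) derive1n_tilde_linear// tilde0.
rewrite (derive1n_cst0 j : derive1n j ((fun=> 0 : R) \o EFin) = _).
by rewrite addr0 normrM ler_wpM2l//; exact: Cbar_norm_ge.
Qed.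

Fact Ctilde_normZ a (u : Ctilde) : Ctilde_norm (a *: u) = `|a| * Ctilde_norm u.
Proof.
apply/eqP; rewrite eq_le Ctilde_normZ_le/=.
have [->|a0] := eqVneq a 0; first by rewrite normr0 mul0r Cbar_norm_ge0.
rewrite -ler_pdivlMl ?normr_gt0// -normfV.
by rewrite (le_trans _ (Ctilde_normZ_le _ _))// scalerA mulVf// scale1r.
Qed.

Fact Ctilde_norm_eq0 (u : Ctilde) : Ctilde_norm u = 0 -> u = 0.
Proof.
move=> u0; apply/val_inj/funext => t /=.
have [Cu ->] := CtildeP u.
have : `|derive1n 0 (tilde n phi u \o EFin) t| <= 0.
  by rewrite -u0; exact: Cbar_norm_ge.
by rewrite normr_le0 => /eqP /= ->; rewrite mulr0.
Qed.

HB.instance Definition _ := Lmodule_isNormed.Build R Ctilde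
  Ctilde_normD Ctilde_normZ Ctilde_norm_eq0.

(* h as an element of the space, with junk value 0 when h is not in it *)
Definition to_Ctilde (h : R -> R) : Ctilde := insubd (0 : Ctilde) h.

End Ctilde.
Arguments Ctilde {R n} phi.
Arguments to_Ctilde {R n} phi h.

(* Lebesgue measure on the Lebesgue (not only Borel) measurable sets *)
Notation leb R := (@completed_lebesgue_measure R).

Notation lebT R := (caratheodory_type (@wlength R idfun)^*%mu).

Definition leb_measurable {R : realType} (h : R -> R) : Prop :=
  measurable_fun setT (fun s : lebT R => h s).

Definition in_L1 {R : realType} (h : R -> R) : Prop :=
  (leb R).-integrable setT (fun s => (h s)%:E).

(* Extended-real valued, so that an infinite inner integral is not silently
   replaced by a finite value. *)
Definition in_Linfty {R : realType} (h : R -> \bar R) : Prop :=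
  measurable_fun setT
    (fun s : lebT R => h s) /\
  (Lnorm (leb R) +oo (fun s => h s) < +oo)%E.

Definition cone {R : realType} {n} {phi : weight R n}
  (alpha : Ctilde phi -> R) : set (Ctilde phi) := [set u | 0 <= alpha u].

Definition integral_op {R : realType} (p : R -> R) (k : R -> R -> R)
    (eta : R -> R) (f : R -> R -> R) (u : R -> R) : R -> R :=
  fun t => p t + \int[leb R]_s (k t s * eta s * f s (u s)).

(* Main.v *)
Require Import Defs.
From mathcomp Require Import all_boot all_order all_algebra.
From mathcomp Require Import all_classical all_reals all_analysis.
From mathcomp Require Import measurable_realfun ring lra.
Import Order.TTheory GRing.Theory Num.Theory.
Import numFieldNormedType.Exports.
Local Open Scope ring_scope.
Local Open Scope classical_set_scope.

(* Let G_j(t,s) be the j-th t-derivative of k(t,s) eta(s) / phi(t).  Since G_(j+1)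
   differs from a difference quotient of G_j with a fixed step by at most a
   multiple of omega_(j+1), all G_j are dominated in s by functions D_j with
   D_j phi_r integrable, starting from D_0 = M.  Hence, with F = f(., u(.)), the
   functions h_j(t) = int G_j(t,s) F(s) ds satisfy h_j' = h_(j+1), are bounded by
   int D_j phi_r, and oscillate by at most
   W_j(t1,t2) = int |G_j(t1,s) - G_j(t2,s)| phi_r(s) ds, which is small when t1
   and t2 are close (by omega_j) and when both are near the same end of the line
   (dominated convergence).  Such bounds define a compact subset of the weighted
   space: an ultrafilter on it converges pointwise with all derivatives, the
   bounds pass to the limit, and the oscillation control makes the convergence
   uniform.  On this set pointwise convergence is norm convergence, so
   continuity of T follows from dominated convergence for each fixed t. *)

(** * Chains of derivatives and moduli of continuity *)

Section smooth.
Context {R : realType}.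
Implicit Types (n j : nat) (h : R -> R).

Lemma Cn_S n h : Cn n.+1 h <-> (forall x, derivable h x 1) /\ Cn n (derive1 h).
Proof.
split=> [[D c]|[d0 [D c]]].
  split; first exact: (D 0%N).
  by split=> [j jn x|]; rewrite -derive1Sn//; exact: D.
split=> [[//|j] jn x|]; rewrite derive1Sn//; exact: D.
Qed.

Lemma CnW n h : Cn n.+1 h -> Cn n h.
Proof.
move=> C; split=> [j jn x|]; first by apply: Cn_derivable C _; exact: ltnW.
exact: Cn_continuous C (leqnSn n).
Qed.

(** Induction on [n] through the first derivative: the product rule expresses it by products of
    functions of class [n], which avoids the Leibniz formula. *)
Lemma Cn_mul n h1 h2 : Cn n h1 -> Cn n h2 -> Cn n (fun t => h1 t * h2 t).
Proof.
elim: n h1 h2 => [|n IH] h1 h2.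
  by move=> [_ c1] [_ c2]; split=> // x; apply: cvgM; [exact: c1|exact: c2].
move=> C1 C2; have [d1 D1] := (Cn_S _ _).1 C1; have [d2 D2] := (Cn_S _ _).1 C2.
apply/Cn_S; split=> [x|]; first by apply: derivableM; [exact: d1|exact: d2].
rewrite (_ : derive1 _ = fun t => 1 * (h1 t * (derive1 h2) t) + h2 t * (derive1 h1) t).
  by apply: Cn_linear; [apply: (IH _ _ (CnW _ _ C1) D2)|apply: (IH _ _ (CnW _ _ C2) D1)].
apply/funext => t; rewrite !derive1E mul1r.
exact: (deriveM (d1 t) (d2 t)).
Qed.

(** The derivatives are named in advance, because below they arise as integrals or as pointwise
    limits and only afterwards turn out to be iterated derivatives. *)
Definition der_chain n (h : nat -> R -> R) :=
  (forall j, (j < n)%N -> forall t : R, is_derive t 1 (h j) (h j.+1 t)) /\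
  continuous (h n).

Lemma der_chain_derive1n n (h : nat -> R -> R) j :
  der_chain n h -> (j <= n)%N -> derive1n j (h 0%N) = h j.
Proof.
move=> [D _]; elim: j => [//|j IH] jn; rewrite derive1nS IH ?(ltnW jn)//.
by apply/funext => t; rewrite derive1E; have ? := D j jn t; exact: derive_val.
Qed.

Lemma der_chain_Cn n (h : nat -> R -> R) : der_chain n h -> Cn n (h 0%N).
Proof.
move=> C; split=> [j jn x|]; rewrite (der_chain_derive1n _ _ _ C)//.
  by have [D _] := C; have ? := D j jn x; exact: ex_derive.
  exact: ltnW.
by case: C.
Qed.

Lemma Cn_der_chain n h : Cn n h -> der_chain n (fun j => derive1n j h).
Proof.
move=> [D c]; split; last exact: c.
move=> j jn t; have d := D j jn t.
by rewrite derive1nS derive1E; apply/derivableP.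
Qed.

(** The difference quotient is multiplied out, so that the estimate can be integrated or passed to a
    pointwise limit. *)
Lemma is_derive_est h (dh t : R) :
  (forall e, 0 < e -> exists2 d, 0 < d & forall x, `|x - t| < d ->
     `|h x - h t - dh * (x - t)| <= e * `|x - t|) ->
  is_derive t 1 h dh.
Proof.
move=> H.
have cv : (fun x : R => x^-1 *: (h (x *: 1 + t) - h t)) @ 0^' --> dh.
  apply/cvgrPdist_le => e e0; have [d d0 Hd] := H _ e0.
  exists d => //= x; rewrite /= sub0r normrN => xd x0.
  have := Hd (x + t); rewrite addrK => /(_ xd).
  rewrite /GRing.scale /= mulr1 => Hx.
  rewrite (_ : dh - _ = - (x^-1 * (h (x + t) - h t - dh * x))); last by field.
  rewrite normrN normrM normfV ler_pdivrMl ?normr_gt0// [leRHS]mulrC; exact: Hx.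
have dt : derivable h t 1 by rewrite /derivable; apply/cvg_ex; exists dh; exact: cv.
apply: DeriveDef; first exact: dt.
exact: cvg_lim cv.
Qed.

(** By the mean value theorem the increment of [h] is [dh c * (x - t)] with [c] between [t] and [x],
    hence within [d] of [t]. The radius [d] depends only on the modulus of [dh], so one radius
    serves a whole family of functions. *)
Lemma linear_approx_le h (dh : R -> R) (t e d : R) :
  (forall x : R, is_derive x 1 h (dh x)) ->
  (forall x, `|x - t| < d -> `|dh x - dh t| <= e) ->
  forall x, `|x - t| < d -> `|h x - h t - dh t * (x - t)| <= e * `|x - t|.
Proof.
move=> Dh He x xd.
have ch a b : {within `[a, b], continuous h}.
  apply: continuous_subspaceT => y.
  by apply/differentiable_continuous/derivable1_diffP; exact: ex_derive.
have [tx|xt] := leP t x.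
  have [c + E] := MVT_segment tx (fun y _ => Dh y) (ch t x).
  rewrite in_itv/= => /andP[tc cx].
  rewrite E -mulrBl normrM ler_wpM2r// He//; move: xd.
  by rewrite !ger0_norm ?subr_ge0//; apply: le_lt_trans; rewrite lerD2r.
have [c + E] := MVT_segment (ltW xt) (fun y _ => Dh y) (ch x t).
rewrite in_itv/= => /andP[xc ct].
rewrite -[h x - h t]opprB E (_ : - _ - _ = (dh c - dh t) * (x - t)); last by ring.
rewrite normrM ler_wpM2r// He//; move: xd.
by rewrite !ler0_norm ?subr_le0// ?(ltW xt)// !opprB; apply: le_lt_trans; rewrite lerD2l lerN2.
Qed.

(* Uniform continuity up to the two points at infinity, in Cauchy form. *)
Definition end_modulus (W : R -> R -> R) := forall e, 0 < e ->
  [/\ exists2 d, 0 < d & forall t1 t2, `|t1 - t2| < d -> W t1 t2 <= e,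
      exists A, forall t1 t2, A <= t1 -> A <= t2 -> W t1 t2 <= e &
      exists A, forall t1 t2, t1 <= A -> t2 <= A -> W t1 t2 <= e].

(** [A] and [B] represent the two ends of the line; a grid of step [d / 2] that starts at [B]
    represents what lies between. This finite net stands in for compactness of the extended line. *)
Lemma end_modulus_net W e : end_modulus W -> 0 < e ->
  exists s : seq R, forall t, exists2 tau, tau \in s & W t tau <= e.
Proof.
move=> HW e0; have [[d d0 Hd] [A HA] [B HB]] := HW _ e0.
have d20 : 0 < d / 2 by rewrite divr_gt0.
exists (A :: B :: [seq B + i%:R * (d / 2) |
                   i <- iota 0 (Num.truncn ((A - B) / (d / 2))).+1]) => t.
have [At|tA] := leP A t; first by exists A; rewrite ?inE ?eqxx// HA.
have [tB|Bt] := leP t B; first by exists B; rewrite ?inE ?eqxx ?orbT// HB.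
pose i := Num.truncn ((t - B) / (d / 2)).
have q0 : 0 <= (t - B) / (d / 2) by rewrite divr_ge0 ?subr_ge0// ltW.
have := truncn_itv q0; rewrite -/i => /andP[i1 i2].
exists (B + i%:R * (d / 2)).
  rewrite in_cons; apply/orP; right; rewrite in_cons; apply/orP; right.
  apply/mapP; exists i => //; rewrite mem_iota leq0n add0n ltnS /i.
  by apply: le_truncn; rewrite ler_wpM2r ?invr_ge0 ?(ltW d20)// lerD2r ltW.
apply: Hd; move: i1 i2; rewrite ler_pdivlMr// ltr_pdivrMr// -[i.+1%:R]natr1 mulrDl mul1r.
move: (i%:R * (d / 2)) => q i1 i2; rewrite ger0_norm; lra.
Qed.

Lemma end_modulus_continuous W h : end_modulus W ->
  (forall t1 t2, `|h t1 - h t2| <= W t1 t2) -> continuous h.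
Proof.
move=> HW hW t; apply/cvgrPdist_le => e e0.
have [[d d0 Hd] _ _] := HW _ e0.
exists d => //= x xd; exact: le_trans (hW _ _) (Hd _ _ xd).
Qed.

Lemma end_modulus_cvg W h : end_modulus W ->
  (forall t1 t2, `|h t1 - h t2| <= W t1 t2) ->
  cvg (h t @[t --> +oo]) /\ cvg (h t @[t --> -oo]).
Proof.
move=> HW hW; split; apply/cauchy_cvgP; apply: cauchy_exP => e e0;
  have e20 : 0 < e / 2 by rewrite divr_gt0.
- have [_ [A HA] _] := HW _ e20; exists (h A).
  exists A; split; first exact: num_real.
  move=> x Ax /=; apply: le_lt_trans (hW _ _) _.
  apply: (@le_lt_trans _ _ (e / 2)); first by apply: HA => //; exact: ltW.
  by rewrite ltr_pdivrMr// ltr_pMr// ltr1n.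
- have [_ _ [A HA]] := HW _ e20; exists (h A).
  exists A; split; first exact: num_real.
  move=> x Ax /=; apply: le_lt_trans (hW _ _) _.
  apply: (@le_lt_trans _ _ (e / 2)); first by apply: HA => //; exact: ltW.
  by rewrite ltr_pdivrMr// ltr_pMr// ltr1n.
Qed.

(** The values at the two infinite points are the limits of [h] itself. *)
Lemma Cbar_extension n h : Cn n h ->
  (forall j, (j <= n)%N -> cvg (derive1n j h t @[t --> +oo]) /\
                           cvg (derive1n j h t @[t --> -oo])) ->
  exists2 g : \bar R -> R, Cbar n g & g \o EFin = h.
Proof.
move=> C L.
pose g (x : \bar R) := match x with
  | r%:E => h r | +oo%E => lim (h t @[t --> +oo])
  | -oo%E => lim (h t @[t --> -oo]) end.
have gh : g \o EFin = h by [].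
exists g => //; split=> //.
have ch : continuous h := Cn_continuous C (leq0n n).
have [hp hm] := L _ (leq0n n).
case=> [r||] A /=.
- move=> /(ch r); rewrite /nbhs/= => -[e e0 He].
  by exists e => //= x; exact: He.
(* A neighbourhood of [+oo] in the extended line contains [+oo] itself; there the value is the
   limit, which [nbhs_singleton] places in [A]. *)
- move=> /[dup] /nbhs_singleton A0 /hp [M [Mr HM]]; exists M; split => // -[x||]//=.
  by rewrite lte_fin; exact: HM.
- move=> /[dup] /nbhs_singleton A0 /hm [M [Mr HM]]; exists M; split => // -[x||]//=.
  by rewrite lte_fin; exact: HM.
Qed.

End smooth.

(** * Compactness in the weighted space *)

Lemma near_all {T : Type} {I : eqType} (F : set_system T) {FF : Filter F}
    (s : seq I) (P : I -> T -> Prop) :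
  (forall i, i \in s -> \forall x \near F, P i x) ->
  \forall x \near F, forall i, i \in s -> P i x.
Proof.
elim: s => [|a s IH] H; first by apply: filterS filterT.
have Ha := H a (mem_head a s).
have Hs : \forall x \near F, forall i, i \in s -> P i x.
  by apply: IH => i si; apply: H; rewrite in_cons si orbT.
apply: filterS2 Ha Hs => x Pa Ps i; rewrite in_cons => /predU1P[->//|].
exact: Ps.
Qed.

(** Compactness of [[- C, C]] gives a cluster point. For an ultrafilter it is a limit, since the
    preimage of each neighbourhood or its complement belongs to [F]. *)
Lemma ultra_bounded_cvg {T : Type} {R : realType} (F : set_system T)
    (f : T -> R) (C : R) : UltraFilter F ->
  (\forall x \near F, `|f x| <= C) -> cvg (f x @[x --> F]).
Proof.
move=> UF FC; have PF : ProperFilter F by exact: ultra_proper.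
have [p [_ pf]] : `[- C, C]%classic `&` cluster (f x @[x --> F]) !=set0.
  apply: segment_compact; apply: filterS FC => x.
  by rewrite /= in_itv/= ler_norml.
apply/cvg_ex; exists p => V Vp; rewrite /nbhs/=.
have [//|FV] := in_ultra_setVsetC (f @^-1` V) UF.
by have [x [/= nV /nV]] := pf (~` V) V FV Vp.
Qed.

Section Ctilde_compact.
Context {R : realType} {n : nat}.
Implicit Types (W : nat -> R -> R -> R) (h g : nat -> R -> R).

(** The modulus of order [j.+1] bounds the first-order remainder of [v u j] by the same quantity for
    all [u] near [F], so the bound survives the limit and identifies the derivative of [g j]. *)
Lemma der_chain_lim {T : Type} (F : set_system T) {PF : ProperFilter F} W
    (v : T -> nat -> R -> R) g :
  (forall j, (j <= n)%N -> end_modulus (W j)) ->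
  (forall j, (j < n)%N -> forall u (t : R), is_derive t 1 (v u j) (v u j.+1 t)) ->
  (\forall u \near F, forall j, (j <= n)%N ->
     forall t1 t2, `|v u j t1 - v u j t2| <= W j t1 t2) ->
  (forall j, (j <= n)%N -> forall t, v u j t @[u --> F] --> g j t) ->
  der_chain n g /\
  forall j, (j <= n)%N -> forall t1 t2, `|g j t1 - g j t2| <= W j t1 t2.
Proof.
move=> HW D FW L.
have gW j : (j <= n)%N -> forall t1 t2, `|g j t1 - g j t2| <= W j t1 t2.
  move=> jn t1 t2; apply: (@cvgr_to_le _ F _ _ (fun u => `|v u j t1 - v u j t2|)).
    by apply: cvg_norm; apply: cvgB; exact: L.
  by apply: filterS FW => u; exact.
split=> //; split; last exact: (end_modulus_continuous _ _ (HW n (leqnn n)) (gW n (leqnn n))).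
move=> j jn t; apply: is_derive_est => e e0.
have [[d d0 Hd] _ _] := HW _ jn _ e0; exists d => // x xd.
apply: (@cvgr_to_le _ F _ _
    (fun u => `|v u j x - v u j t - v u j.+1 t * (x - t)|)).
  apply: cvg_norm; apply: cvgB; first by apply: cvgB; apply: L; exact: ltnW.
  by apply: cvgM; [exact: L|exact: cvg_cst].
apply: filterS FW => u uW; apply: linear_approx_le xd => y; first exact: D.
by move=> yd; apply: le_trans (Hd _ _ yd); exact: uW.
Qed.

Variable phi : weight R n.

(** For [u] in the weighted space this is the derivative of order [j] of [u / phi]. *)
Definition tder (u : R -> R) j := derive1n j (tilde n phi u \o EFin).

Lemma Ctilde_der_chain (u : Ctilde phi) : der_chain n (tder u).
Proof. by have [[_ C _] _] := CtildeP u; exact: Cn_der_chain. Qed.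

Lemma CtildeE (u : Ctilde phi) t : u t = phi t * tder u 0 t.
Proof. by have [_ ->] := CtildeP u. Qed.

Lemma Ctilde_in (u : Ctilde phi) : in_Ctilde n phi u.
Proof. by case: u => u /=; rewrite inE. Qed.

Lemma to_CtildeE (h : R -> R) : in_Ctilde n phi h -> to_Ctilde phi h = h :> (R -> R).
Proof. by move=> H; rewrite /to_Ctilde; exact: (insubdK _ (mem_set H)). Qed.

Lemma tder_linear a (u v : Ctilde phi) j t : (j <= n)%N ->
  tder (a *: u + v : Ctilde phi) j t = a * tder u j t + tder v j t.
Proof. by move=> jn; rewrite /tder derive1n_tilde_linear. Qed.

Lemma tderB (u v : Ctilde phi) j t : (j <= n)%N ->
  tder (u - v : Ctilde phi) j t = tder u j t - tder v j t.
Proof.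
by move=> jn; rewrite addrC -scaleN1r tder_linear// mulN1r addrC.
Qed.

Lemma normr_tder_le (u : Ctilde phi) j t : (j <= n)%N -> `|tder u j t| <= `|u|.
Proof. by move=> jn; apply: Cbar_norm_ge => //; exact: (CtildeP u).1. Qed.

Lemma Ctilde_norm_le (u : Ctilde phi) (M : R) : 0 <= M ->
  (forall j t, (j <= n)%N -> `|tder u j t| <= M) -> `|u| <= M.
Proof. exact: Cbar_norm_le. Qed.

(** The moduli give the limits at both ends by the Cauchy criterion, hence an extension of [h 0] to
    the extended line; uniqueness of the factor identifies [tder]. *)
Lemma der_chain_in_Ctilde W h : (forall j, (j <= n)%N -> end_modulus (W j)) ->
  der_chain n h ->
  (forall j, (j <= n)%N -> forall t1 t2, `|h j t1 - h j t2| <= W j t1 t2) ->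
  in_Ctilde n phi (fun t => phi t * h 0%N t) /\
  forall j, (j <= n)%N -> tder (fun t => phi t * h 0%N t) j = h j.
Proof.
move=> HW C hW; have Ch := der_chain_Cn _ _ C.
have [g Cg gh] : exists2 g : \bar R -> R, Cbar n g & g \o EFin = h 0%N.
  apply: Cbar_extension Ch _ => j jn; rewrite (der_chain_derive1n _ _ _ C jn).
  exact: end_modulus_cvg (HW j jn) (hW j jn).
have fg : factor_of n phi (fun t => phi t * h 0%N t) g.
  by split => // t; rewrite -gh.
split; first by split; [exact: Cn_mul (weight_Cn phi) Ch|exists g].
by move=> j jn; rewrite /tder (tilde_eq fg) gh (der_chain_derive1n _ _ _ C jn).
Qed.

(** An Arzela-Ascoli set: a common bound and a common modulus for each order. When [W j] is an
    [end_modulus], it also controls the behaviour at infinity. *)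
Definition equi_set (C : nat -> R) W : set (Ctilde phi) :=
  [set u | forall j, (j <= n)%N ->
    (forall t, `|tder u j t| <= C j) /\
    forall t1 t2, `|tder u j t1 - tder u j t2| <= W j t1 t2].

(** Convergence at the finitely many points of a net spreads to the whole line through the common
    modulus. The filter is arbitrary, so the lemma serves both ultrafilters (compactness) and
    sequences (continuity). *)
Lemma equi_set_cvg {T : Type} (F : set_system T) {FF : Filter F} C W
    (U : T -> Ctilde phi) (v : Ctilde phi) :
  (forall j, (j <= n)%N -> end_modulus (W j)) ->
  (\forall x \near F, equi_set C W (U x)) -> equi_set C W v ->
  (forall j, (j <= n)%N -> forall t, tder (U x) j t @[x --> F] --> tder v j t) ->
  U x @[x --> F] --> v.
Proof.
move=> HW FK vK L; apply/cvgrPdist_le => e e0.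
have e30 : 0 < e / 3 by rewrite divr_gt0.
have Fe : \forall x \near F, forall j, j \in iota 0 n.+1 ->
    forall t, `|tder v j t - tder (U x) j t| <= e.
  apply: near_all => j; rewrite mem_iota add0n ltnS => /= jn.
  have [s Hs] := end_modulus_net _ _ (HW j jn) e30.
  have Fs : \forall x \near F, forall tau, tau \in s ->
      `|tder v j tau - tder (U x) j tau| <= e / 3.
    by apply: near_all => tau _; have /cvgrPdist_le := L j jn tau; exact.
  (* Three errors of [e / 3]: from [t] to [tau] in [v], from [v] to [U x] at [tau], and from [tau]
     back to [t] in [U x]. *)
  apply: filterS2 Fs FK => x xs xK t.
  have [tau st Wt] := Hs t; have := xs tau st.
  have [_ /(_ t tau)] := vK j jn; have [_ /(_ t tau)] := xK j jn.
  move: (tder v j t) (tder v j tau) (tder _ j t) (tder _ j tau) => a b c d.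
  rewrite !ler_norml => /andP[? ?] /andP[? ?] /andP[? ?].
  by apply/andP; split; lra.
apply: filterS Fe => x xe; apply: Ctilde_norm_le; first exact: ltW.
by move=> j t jn; rewrite tderB//; apply: xe; rewrite mem_iota add0n ltnS.
Qed.

Lemma compact_equi_set C W : (forall j, (j <= n)%N -> end_modulus (W j)) ->
  compact (equi_set C W).
Proof.
move=> HW; rewrite compact_ultra => F UF FK.
have PF : ProperFilter F by exact: ultra_proper.
pose ev j t := fun u : Ctilde phi => tder u j t.
pose g j t := lim (ev j t @ F).
have Lg j : (j <= n)%N -> forall t, ev j t u @[u --> F] --> g j t.
  move=> jn t; apply: (ultra_bounded_cvg _ _ (C j) UF).
  by apply: filterS FK => u /(_ _ jn)[+ _]; exact.
have [Cg gW] : der_chain n g /\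
    forall j, (j <= n)%N -> forall t1 t2, `|g j t1 - g j t2| <= W j t1 t2.
  apply: (der_chain_lim F W (fun u : Ctilde phi => tder u) g HW _ _ Lg).
    by move=> j jn u t; have [D _] := Ctilde_der_chain u; exact: D.
  by apply: filterS FK => u uK j jn; have [] := uK j jn.
have [gin gE] := der_chain_in_Ctilde W g HW Cg gW.
(* The pointwise limits form a chain with the same moduli, so [phi * g 0] is a genuine element of
   the space and not the default value. *)
pose v := to_Ctilde phi (fun t => phi t * g 0%N t).
have vE j : (j <= n)%N -> tder v j = g j.
  by move=> jn; rewrite /v to_CtildeE// gE.
have vK : equi_set C W v.
  move=> j jn; rewrite vE//; split; last exact: gW.
  move=> t; apply: (@cvgr_to_le _ F _ _ (fun u => `|ev j t u|)).
    by apply: cvg_norm; exact: Lg.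
  by apply: filterS FK => u /(_ _ jn)[+ _]; exact.
exists v; split; first exact: vK.
apply: (@equi_set_cvg _ F _ C W (fun u => u) v HW FK vK) => j jn t.
by rewrite vE//; exact: Lg.
Qed.

End Ctilde_compact.

(** * Dominated integrals and Lebesgue measurability *)

Section dominated.
Context {d} {T : measurableType d} {R : realType} (mu : {measure set T -> \bar R}).
Implicit Types (g h : T -> R).

Lemma integrable_measurable h : mu.-integrable setT (EFin \o h) ->
  measurable_fun setT h.
Proof. by move=> /measurable_int /measurable_EFinP. Qed.

Lemma integrable_dominated h g : measurable_fun setT h ->
  {ae mu, forall s, `|h s| <= g s} -> mu.-integrable setT (EFin \o g) ->
  mu.-integrable setT (EFin \o h).
Proof.
move=> mh hg ig; have mg := integrable_measurable _ ig.
have /integrableP[_ ig'] := ig.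
apply/integrableP; split; first exact/measurable_EFinP.
apply: le_lt_trans ig'; apply: ae_ge0_le_integral => //.
- by apply: measurableT_comp => //; exact/measurable_EFinP.
- by apply: measurableT_comp => //; exact/measurable_EFinP.
- apply: filterS hg => s hs _ /=; rewrite lee_fin.
  by apply: le_trans hs _; exact: ler_norm.
Qed.

Lemma integrable_linear (a : R) h g : mu.-integrable setT (EFin \o h) ->
  mu.-integrable setT (EFin \o g) ->
  mu.-integrable setT (EFin \o (fun s => a * h s + g s)).
Proof.
move=> ih ig.
exact: (integrableD measurableT (integrableZl measurableT a ih) ig).
Qed.

Lemma le_ae_Rintegral h g : mu.-integrable setT (EFin \o h) ->
  mu.-integrable setT (EFin \o g) -> {ae mu, forall s, h s <= g s} ->
  \int[mu]_s h s <= \int[mu]_s g s.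
Proof.
move=> ih ig hg; rewrite -subr_ge0 -RintegralB//.
(* [g - h] is nonnegative only almost everywhere; its absolute value has the same integral and is
   nonnegative everywhere. *)
rewrite (_ : \int[mu]_s (g s - h s) = \int[mu]_s `|g s - h s|).
  by apply: Rintegral_ge0.
have mgh : measurable_fun setT (fun s => g s - h s).
  by apply: measurable_funB; exact: integrable_measurable.
congr fine; apply: ae_eq_integral => //.
- exact/measurable_EFinP.
- by apply/measurable_EFinP; exact: measurableT_comp.
- by apply: filterS hg => s hs _; rewrite ger0_norm// subr_ge0.
Qed.

Lemma normr_Rintegral_le h g : measurable_fun setT h ->
  {ae mu, forall s, `|h s| <= g s} -> mu.-integrable setT (EFin \o g) ->
  `|\int[mu]_s h s| <= \int[mu]_s g s.
Proof.
move=> mh hg ig; have ih := integrable_dominated _ _ mh hg ig.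
apply: (le_trans (le_normr_Rintegral measurableT ih)).
by apply: le_ae_Rintegral => //; exact: (integrable_norm ih).
Qed.

Lemma dominated_Rintegral_cvg0 (h : nat -> T -> R) g :
  (forall m, measurable_fun setT (h m)) ->
  {ae mu, forall s m, `|h m s| <= g s} -> mu.-integrable setT (EFin \o g) ->
  {ae mu, forall s, h m s @[m --> \oo] --> 0} ->
  \int[mu]_s h m s @[m --> \oo] --> 0.
Proof.
move=> mh hg ig h0.
have mhE m : measurable_fun setT (fun s => (h m s)%:E) by exact/measurable_EFinP.
have h0E : {ae mu, forall s, setT s -> (h m s)%:E @[m --> \oo] --> 0%E}.
  by apply: filterS h0 => s hs _; apply: cvg_EFin; [exact: nearW|exact: hs].
have hgE : {ae mu, forall s m, setT s -> (`|(h m s)%:E| <= (g s)%:E)%E}.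
  by apply: filterS hg => s hs m _; rewrite lee_fin.
have [_ _] := dominated_convergence measurableT mhE (measurable_cst 0%E) h0E ig hgE.
by rewrite integral0 => /fine_cvg.
Qed.

(** A countable union of null sets is null; [pickle] reduces the index type to the natural
    numbers. *)
Lemma ae_forall_countable (I : countType) (P : I -> T -> Prop) :
  (forall i, {ae mu, forall s, P i s}) -> {ae mu, forall s i, P i s}.
Proof.
move=> H; have := @ae_foralln _ _ _ mu
  (fun k s => if unpickle k is Some i then P i s else True).
move=> aeP; suff /aeP : forall k, {ae mu, forall s, if unpickle k is Some i then P i s else True}.
  by apply: filterS => s Hs i; have := Hs (pickle i); rewrite pickleK.
by move=> k; case: (unpickle k) => [i|]; [exact: H|exact: aeW].
Qed.

(** The derivative is the pointwise limit of the difference quotients with step [m.+1%:R^-1], each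
    measurable in [s]. *)
Lemma measurable_fun_is_derive (g g' : R -> T -> R) :
  (forall s (t : R), is_derive t 1 (g ^~ s) (g' t s)) ->
  (forall t, measurable_fun setT (g t)) -> forall t, measurable_fun setT (g' t).
Proof.
move=> D mg t.
apply: (measurable_fun_cvg
    (h := fun m s => m.+1%:R * (g (m.+1%:R^-1 + t) s - g t s))).
  by move=> m; apply: measurable_funM => //; exact: measurable_funB.
move=> s _.
have /cvgrPdist_le H : (fun x : R => x^-1 *: (g (x *: 1 + t) s - g t s)) @ 0^' --> g' t s.
  have Ds := D s t; rewrite -(@derive_val _ _ _ _ _ _ _ Ds).
  exact: (@ex_derive _ _ _ _ _ _ _ Ds).
apply/cvgrPdist_le => e /H [del /= del0 He].
near=> m.
have := He m.+1%:R^-1; rewrite /= sub0r normrN invrK.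
rewrite /GRing.scale /= mulr1; apply; last by rewrite invr_eq0.
rewrite ger0_norm ?invr_ge0//.
by near: m; exact: (near_infty_natSinv_lt (PosNum del0)).
Unshelve. all: by end_near. Qed.

(** The negative part of [h] vanishes almost everywhere, so completeness makes it measurable with
    integral zero; the integral of the positive part is nonnegative for an arbitrary [h]. *)
Lemma complete_integral_ge0 (h : T -> \bar R) : measure_is_complete mu ->
  {ae mu, forall s, (0 <= h s)%E} -> (0 <= \int[mu]_s h s)%E.
Proof.
move=> cmu h0; rewrite integralE (_ : \int[mu]_s (h^\-)%E s = 0)%E.
  by rewrite sube0; exact: integral_ge0.
have hn0 : ae_eq mu setT (cst 0%E) (h^\-)%E.
  apply: filterS h0 => s hs _ /=; rewrite funenegE; apply/esym/max_idPr.
  by rewrite leeNl oppe0.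
have mhn := ae_measurable_fun cmu hn0 (measurable_cst _).
by rewrite -(ae_eq_integral _ _ measurableT (measurable_cst _) mhn hn0) integral0.
Qed.

End dominated.

(** * Measurability for the completed Lebesgue measure *)

Section lebesgue.
Context {R : realType}.
Implicit Types (g h u : R -> R).

#[global] Instance leb_ae_filter : Filter (almost_everywhere (leb R)).
Proof. exact: (ae_filter_ringOfSetsType (leb R)). Qed.

(** The approximants lie in a countable set, indexed by a natural number and an integer. They reduce
    statements about all reals to countably many. *)
Lemma floor_approx_cvg (x : R) :
  (Num.floor (m.+1%:R * x))%:~R / m.+1%:R @[m --> \oo] --> x.
Proof.
apply/cvgrPdist_le => e e0.
near=> m; have m0 : 0 < m.+1%:R :> R by [].
have /andP[q1 q2] := floor_itv (m.+1%:R * x).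
rewrite ler_norml; apply/andP; split.
  apply: (@le_trans _ _ 0); first by rewrite oppr_le0 ltW.
  by rewrite subr_ge0 ler_pdivrMr// [leRHS]mulrC.
apply: (@le_trans _ _ m.+1%:R^-1); last first.
  by apply: ltW; near: m; exact: (near_infty_natSinv_lt (PosNum e0)).
rewrite lerBlDl -[X in _ + X]mul1r -mulrDl ler_pdivlMr// [leLHS]mulrC.
by move: q2; rewrite intrD => /ltW.
Unshelve. all: by end_near. Qed.

Lemma ae_leb_measurable g h : {ae leb R, forall s, g s = h s} ->
  leb_measurable g -> leb_measurable h.
Proof.
move=> gh mg; apply/measurable_EFinP.
apply: (ae_measurable_fun completed_lebesgue_measure_is_complete (f := EFin \o g)).
  by apply: filterS gh => s + _ /=; move=> ->.
by apply/measurable_EFinP.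
Qed.

Lemma borel_leb_preimage h (A : set R) : measurable A -> leb_measurable h ->
  measurable (h @^-1` A : set (lebT R)).
Proof. by move=> mA mh; rewrite -[X in measurable X]setTI; exact: mh. Qed.

Lemma continuous_leb_measurable h : continuous h -> leb_measurable h.
Proof.
move=> ch _ B mB; apply: sub_caratheodory.
exact: (continuous_measurable_fun ch measurableT mB).
Qed.

(* A Caratheodory function: [f (u t)] is the limit of [f (q t)] for the step
   functions [q = floor (m * u) / m]. *)
Lemma leb_measurable_superposition (f : R -> R -> R) u :
  (forall y, leb_measurable (f^~ y)) -> (\forall t \ae leb R, continuous (f t)) ->
  leb_measurable u -> leb_measurable (fun t => f t (u t)).
Proof.
move=> mf cf mu.
pose q (m : nat) (t : R) : R := (Num.floor (m.+1%:R * u t))%:~R / m.+1%:R.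
have mq m : leb_measurable (fun t => f t (q m t)).
  (* The pieces on which [q m] is constant, numbered by the code of the integer
     [floor (m.+1 * u t)]; a [k] that codes no integer gives an empty piece. *)
  pose E k : set (lebT R) := [set t | pickle (Num.floor (m.+1%:R * u t)) = k].
  have mE k : measurable (E k).
    have [[z zk]|nk] := pselect (exists z : int, pickle z = k); last first.
      rewrite (_ : E k = set0); first exact: measurable0.
      by rewrite -subset0 => t Et; apply: nk; eexists; exact: Et.
    rewrite (_ : E k = u @^-1` `[z%:~R / m.+1%:R, (z + 1)%:~R / m.+1%:R[%classic).
      exact: borel_leb_preimage.
    apply/seteqP; split=> t; rewrite /E /= in_itv/= ler_pdivrMr// ltr_pdivlMr//.
      rewrite -zk => /(pcan_inj pickleK) <-.
      by rewrite ![_ * m.+1%:R]mulrC; exact: floor_itv.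
    rewrite ![_ * m.+1%:R]mulrC -zk => zu; congr pickle.
    exact: floor_def.
  have UE : \bigcup_k E k = setT.
    by apply/seteqP; split=> // t _; exists (pickle (Num.floor (m.+1%:R * u t))).
  rewrite /leb_measurable -UE; apply/(measurable_fun_bigcup _ mE) => k.
  have [[z zk]|nk] := pselect (exists z : int, pickle z = k); last first.
    rewrite (_ : E k = set0); first exact: measurable_fun_set0.
    by rewrite -subset0 => t Et; apply: nk; eexists; exact: Et.
  apply: (eq_measurable_fun (fun t : lebT R => f t (z%:~R / m.+1%:R))).
    by move=> t /[!inE]; rewrite /E/= -zk => /(pcan_inj pickleK) <-.
  exact: (measurable_funS measurableT (@subsetT _ (E k)) (mf _)).
have qu t : q m t @[m --> \oo] --> u t by exact: floor_approx_cvg.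
(* The upper limit is measurable without a convergence assumption, and it equals the limit wherever
   [f t] is continuous. *)
apply: (ae_leb_measurable (fun t => fine (limn_esup (fun m => (f t (q m t))%:E)))).
  apply: filterS cf => t ct.
  have fq : (f t (q m t))%:E @[m --> \oo] --> (f t (u t))%:E.
    have fq : f t (q m t) @[m --> \oo] --> f t (u t) := cvg_comp _ _ (qu t) (ct (u t)).
    by apply: cvg_EFin; [exact: nearW|exact: fq].
  by rewrite is_cvg_limn_esupE; [rewrite (cvg_lim _ fq)|apply/cvg_ex; eexists; exact: fq].
have ml : measurable_fun setT
    (fun t : lebT R => limn_esup (fun m => (f t (q m t))%:E)).
  apply: (measurable_fun_limn_esup (f := fun m (t : lebT R) => (f t (q m t))%:E)) => m.
  by apply/measurable_EFinP; exact: mq.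
rewrite /leb_measurable; apply: (measurableT_comp (f := @fine R)); last exact: ml.
exact: fine_measurable.
Qed.

End lebesgue.

(** * Integral operators with a differentiable kernel *)

Section kernel.
Context {d} {T : measurableType d} {R : realType} (mu : {measure set T -> \bar R}).
Variables (n : nat) (G : nat -> R -> T -> R) (omega D : nat -> T -> R).
Variable psi : T -> R.

Hypothesis Gder : forall j, (j < n)%N -> forall s (t : R),
  is_derive t 1 (G j ^~ s) (G j.+1 t s).
Hypothesis Glim : forall j, (j <= n)%N -> forall s,
  cvg (G j t s @[t --> +oo]) /\ cvg (G j t s @[t --> -oo]).
Hypothesis Gmeas : forall j, (j <= n)%N -> forall t, measurable_fun setT (G j t).
Hypothesis Gomega : forall j, (j <= n)%N -> forall e : R, 0 < e ->
  exists2 del : R, 0 < del & {ae mu, forall s, forall t1 t2, `|t1 - t2| < del ->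
    `|G j t1 s - G j t2 s| <= e * omega j s}.
Hypothesis GD : forall j, (j <= n)%N -> {ae mu, forall s, forall t, `|G j t s| <= D j s}.
Hypothesis ipsi : mu.-integrable setT (EFin \o psi).
Hypothesis psi0 : {ae mu, forall s, 0 <= psi s}.
Hypothesis iomega : forall j, (j <= n)%N ->
  mu.-integrable setT (EFin \o (fun s => omega j s * psi s)).
Hypothesis iD : forall j, (j <= n)%N ->
  mu.-integrable setT (EFin \o (fun s => D j s * psi s)).

(** The modulus [W_j] with [psi] in place of the density, so that it is common to all densities
    dominated by [psi]. *)
Definition osc j t1 t2 := \int[mu]_s (`|G j t1 s - G j t2 s| * psi s).

Let mosc j t1 t2 : (j <= n)%N ->
  measurable_fun setT (fun s => `|G j t1 s - G j t2 s| * psi s).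
Proof.
move=> jn; apply: measurable_funM; last exact: integrable_measurable ipsi.
by apply: measurableT_comp => //; apply: measurable_funB; exact: Gmeas.
Qed.

Let i2D j : (j <= n)%N ->
  mu.-integrable setT (EFin \o (fun s => 1 * (D j s * psi s) + D j s * psi s)).
Proof. by move=> jn; apply: integrable_linear; exact: iD. Qed.

Let osc_le2D j : (j <= n)%N -> {ae mu, forall s, forall t1 t2,
  `| `|G j t1 s - G j t2 s| * psi s| <= 1 * (D j s * psi s) + D j s * psi s}.
Proof.
move=> jn; apply: filterS2 (GD j jn) psi0 => s Ds ps t1 t2.
rewrite ger0_norm ?mulr_ge0// mul1r -mulrDl ler_wpM2r//.
by apply: (le_trans (ler_normB _ _)); exact: lerD.
Qed.

Lemma osc_cvg0 j (t1 t2 : nat -> R) : (j <= n)%N ->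
  (forall s, G j (t1 m) s - G j (t2 m) s @[m --> \oo] --> 0) ->
  osc j (t1 m) (t2 m) @[m --> \oo] --> 0.
Proof.
move=> jn H; apply: dominated_Rintegral_cvg0 (i2D _ jn) _.
- by move=> m; exact: mosc.
- by apply: filterS (osc_le2D _ jn) => s + m; exact.
- apply: aeW => s; rewrite -(mul0r (psi s)); apply: cvgM; last exact: cvg_cst.
  by rewrite -(@normr0 _ R); apply: cvg_norm; exact: H.
Qed.

(** Nearby points are handled by [omega]. The ends are handled by contradiction, since dominated
    convergence is about sequences: failure would give pairs that go to the same end and keep [osc]
    above [e]. *)
Lemma osc_end_modulus j : (j <= n)%N -> end_modulus (osc j).
Proof.
move=> jn e e0; split.
- pose c := \int[mu]_s (omega j s * psi s).
  (* Dividing by [1 + |c|] covers the case where [c] is zero. *)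
  have c1 : 0 < 1 + `|c| by rewrite ltr_pwDl.
  have [del d0 Hd] := Gomega j jn _ (divr_gt0 e0 c1).
  exists del => // t1 t2 td.
  apply: (@le_trans _ _ (e / (1 + `|c|) * c)); last first.
    rewrite mulrAC ler_pdivrMr// ler_wpM2l ?(ltW e0)//.
    by rewrite (le_trans (ler_norm _))// lerDr.
  rewrite -RintegralZl//; last exact: iomega.
  apply: (le_trans (ler_norm _)); apply: normr_Rintegral_le; first exact: mosc.
    apply: filterS2 Hd psi0 => s /(_ _ _ td) Hs ps /=.
    by rewrite ger0_norm ?mulr_ge0// mulrA ler_wpM2r.
  exact: (integrableZl measurableT (e / (1 + `|c|)) (iomega j jn)).
- apply: contrapT => nA.
  have /choice[t Ht] : forall m : nat, exists t : R * R,
      [/\ m%:R <= t.1, m%:R <= t.2 & e < osc j t.1 t.2].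
    move=> m; apply: contrapT => nt; apply: nA; exists m%:R => t1 t2 mt1 mt2.
    by rewrite leNgt; apply/negP => et; apply: nt; exists (t1, t2).
  have /cvgrPdist_le/(_ _ e0)[m _ /(_ m (leqnn m))/=] :
      osc j (t m).1 (t m).2 @[m --> \oo] --> 0.
    apply: osc_cvg0 => // s; have [/cvg_ex[l Gl] _] := Glim j jn s.
    (* Both sequences of kernel values tend to the same end limit [l], so their difference tends to
       zero. *)
    have tt (u : nat -> R) : (forall m, m%:R <= u m) -> G j (u m) s @[m --> \oo] --> l.
      move=> mu'; move/cvg_pinftyP : Gl; apply; apply/cvgryPge => A.
      near=> m; apply: le_trans (mu' m).
      by near: m; exact: nbhs_infty_ger.
    rewrite -(subrr l); apply: cvgB; apply: tt => m; by have [] := Ht m.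
  have [_ _ em] := Ht m; rewrite sub0r normrN => /(le_trans (ler_norm _)).
  by rewrite leNgt em.
- apply: contrapT => nA.
  have /choice[t Ht] : forall m : nat, exists t : R * R,
      [/\ t.1 <= - m%:R, t.2 <= - m%:R & e < osc j t.1 t.2].
    move=> m; apply: contrapT => nt; apply: nA; exists (- m%:R) => t1 t2 mt1 mt2.
    by rewrite leNgt; apply/negP => et; apply: nt; exists (t1, t2).
  have /cvgrPdist_le/(_ _ e0)[m _ /(_ m (leqnn m))/=] :
      osc j (t m).1 (t m).2 @[m --> \oo] --> 0.
    apply: osc_cvg0 => // s; have [_ /cvg_ex[l Gl]] := Glim j jn s.
    have tt (u : nat -> R) : (forall m, u m <= - m%:R) -> G j (u m) s @[m --> \oo] --> l.
      move=> mu'; move/cvg_ninftyP : Gl; apply; apply/cvgrNyPle => A.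
      near=> m; apply: (le_trans (mu' m)); rewrite lerNl.
      by near: m; exact: nbhs_infty_ger.
    rewrite -(subrr l); apply: cvgB; apply: tt => m; by have [] := Ht m.
  have [_ _ em] := Ht m; rewrite sub0r normrN => /(le_trans (ler_norm _)).
  by rewrite leNgt em.
Unshelve. all: by end_near. Qed.

Definition kint (F : T -> R) j t := \int[mu]_s (G j t s * F s).

Section density.
Variable F : T -> R.
Hypothesis mF : measurable_fun setT F.
Hypothesis Fpsi : {ae mu, forall s, `|F s| <= psi s}.

Let mGF j t : (j <= n)%N -> measurable_fun setT (fun s => G j t s * F s).
Proof. by move=> jn; apply: measurable_funM => //; exact: Gmeas. Qed.

Let GF_le j : (j <= n)%N ->
  {ae mu, forall s, forall t, `|G j t s * F s| <= D j s * psi s}.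
Proof.
move=> jn; apply: filterS2 (GD j jn) Fpsi => s Ds Fs t.
by rewrite normrM ler_pM.
Qed.

Lemma integrable_kernel j t : (j <= n)%N ->
  mu.-integrable setT (EFin \o (fun s => G j t s * F s)).
Proof.
move=> jn; apply: integrable_dominated (iD _ jn); first exact: mGF.
by apply: filterS (GF_le _ jn) => s; exact.
Qed.

Lemma normr_kint_le j t : (j <= n)%N ->
  `|kint F j t| <= \int[mu]_s (D j s * psi s).
Proof.
move=> jn; apply: normr_Rintegral_le (iD _ jn); first exact: mGF.
by apply: filterS (GF_le _ jn) => s; exact.
Qed.

Lemma kint_osc j t1 t2 : (j <= n)%N ->
  `|kint F j t1 - kint F j t2| <= osc j t1 t2.
Proof.
move=> jn; rewrite /kint -RintegralB//; [|exact: integrable_kernel..].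
rewrite (_ : (fun s => _) = fun s => (G j t1 s - G j t2 s) * F s); last first.
  by apply/funext => s; rewrite mulrBl.
apply: normr_Rintegral_le.
- apply: measurable_funM => //.
  by apply: measurable_funB; exact: Gmeas.
- apply: filterS Fpsi => s Fs; rewrite normrM ler_wpM2l//.
- apply: integrable_dominated (i2D _ jn); first exact: mosc.
  by apply: filterS (osc_le2D _ jn) => s; exact.
Qed.

(** Differentiation under the integral: for almost every [s] the first-order remainder of [G j] is
    at most a small multiple of [omega j.+1 s * |x - t|], and this is integrated against [psi]. *)
Lemma kint_is_derive j (t : R) : (j < n)%N -> is_derive t 1 (kint F j) (kint F j.+1 t).
Proof.
move=> jn; apply: is_derive_est => e e0.
pose c := \int[mu]_s (omega j.+1 s * psi s).
have c1 : 0 < 1 + `|c| by rewrite ltr_pwDl.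
have [del d0 Hd] := Gomega j.+1 jn _ (divr_gt0 e0 c1).
exists del => // x xd.
pose a := e / (1 + `|c|) * `|x - t|.
have -> : kint F j x - kint F j t - kint F j.+1 t * (x - t) =
    \int[mu]_s ((G j x s - G j t s - G j.+1 t s * (x - t)) * F s).
  have iB y := integrable_kernel j y (ltnW jn).
  have iZ := integrable_kernel j.+1 t jn.
  rewrite /kint -RintegralB// -RintegralZr// -RintegralB//.
  - by congr (Rintegral _ _ _); apply/funext => s; ring.
  - exact: (integrableB measurableT (iB x) (iB t)).
  - exact: (integrableZr measurableT (x - t) iZ).
apply: (@le_trans _ _ (a * c)); last first.
  rewrite /a mulrAC ler_wpM2r// mulrAC ler_pdivrMr// ler_wpM2l ?(ltW e0)//.
  by rewrite (le_trans (ler_norm _))// lerDr.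
rewrite -RintegralZl//; last exact: iomega.
apply: normr_Rintegral_le.
- apply: measurable_funM => //; apply: measurable_funB.
    by apply: measurable_funB; apply: Gmeas; exact: ltnW.
  by apply: measurable_funM => //; exact: Gmeas.
- apply: filterS2 Hd Fpsi => s Hs Fs.
  have ps : 0 <= psi s := le_trans (normr_ge0 _) Fs.
  rewrite normrM mulrA ler_pM// /a mulrAC.
  (* The exceptional null set in [Gomega] does not depend on the two points, so the mean value
     estimate applies for a fixed [s]. *)
  exact: (linear_approx_le (G j ^~ s) (G j.+1 ^~ s) t _ del (Gder j jn s)
    (fun y => Hs y t) x xd).
- exact: (integrableZl measurableT a (iomega j.+1 jn)).
Qed.

Lemma kint_der_chain : der_chain n (kint F).
Proof.
split; first by move=> j jn t; exact: kint_is_derive.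
apply: (end_modulus_continuous _ _ (osc_end_modulus n (leqnn n))) => t1 t2.
exact: kint_osc.
Qed.

End density.

(** Dominated convergence at a single [t], with majorant [2 * D j * psi]; [equi_set_cvg] later turns
    this into norm convergence. *)
Lemma kint_cvg (F_ : nat -> T -> R) (F : T -> R) j (t : R) : (j <= n)%N ->
  (forall m, measurable_fun setT (F_ m)) -> measurable_fun setT F ->
  (forall m, {ae mu, forall s, `|F_ m s| <= psi s}) ->
  {ae mu, forall s, `|F s| <= psi s} ->
  {ae mu, forall s, F_ m s @[m --> \oo] --> F s} ->
  kint (F_ m) j t @[m --> \oo] --> kint F j t.
Proof.
move=> jn mF_ mF F_psi Fpsi F_F.
have E m : kint F j t - kint (F_ m) j t = \int[mu]_s (G j t s * (F s - F_ m s)).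
  rewrite /kint -RintegralB//; [|exact: integrable_kernel..].
  by congr (Rintegral _ _ _); apply/funext => s; rewrite mulrBr.
suff H0 : kint F j t - kint (F_ m) j t @[m --> \oo] --> 0.
  rewrite -[X in _ --> X]subr0; apply: cvg_trans (cvgB (cvg_cst (kint F j t)) H0).
  by apply: near_eq_cvg; near=> m; rewrite opprB addrC subrK.
under eq_fun do rewrite E.
apply: dominated_Rintegral_cvg0 (i2D _ jn) _.
- move=> m; apply: measurable_funM; first exact: Gmeas.
  exact: measurable_funB.
- have F_all := ae_foralln F_psi.
  apply: filterS3 (GD j jn) Fpsi F_all => s Ds Fs F_s m.
  rewrite normrM mul1r -mulrDr ler_pM//.
  by apply: (le_trans (ler_normB _ _)); exact: lerD.
- apply: filterS F_F => s Fs; rewrite -(mulr0 (G j t s)) -(subrr (F s)).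
  by apply: cvgM; [exact: cvg_cst|apply: cvgB => //; exact: cvg_cst].
Unshelve. all: by end_near. Qed.

End kernel.

(** * Dominating functions for all derivatives of the kernel *)

Section kernel_bound.
Context {d} {T : measurableType d} {R : realType} (mu : {measure set T -> \bar R}).
Variables (n : nat) (G : nat -> R -> T -> R) (omega : nat -> T -> R) (M : T -> R).
Variable Psi : set (T -> R).

Hypothesis Gder : forall j, (j < n)%N -> forall s (t : R),
  is_derive t 1 (G j ^~ s) (G j.+1 t s).
Hypothesis Gomega : forall j, (j <= n)%N -> forall e : R, 0 < e ->
  exists2 del : R, 0 < del & {ae mu, forall s, forall t1 t2, `|t1 - t2| < del ->
    `|G j t1 s - G j t2 s| <= e * omega j s}.
Hypothesis GM : {ae mu, forall s, forall t, `|G 0%N t s| <= M s}.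
Hypothesis iM : forall psi, Psi psi ->
  mu.-integrable setT (EFin \o (fun s => M s * psi s)).
Hypothesis iomega : forall psi, Psi psi -> forall j, (j <= n)%N ->
  mu.-integrable setT (EFin \o (fun s => omega j s * psi s)).

(* [G j.+1] differs from a difference quotient of [G j] with a fixed step by at
   most [omega j.+1]. *)
Lemma kernel_bound : exists D : nat -> T -> R, forall j, (j <= n)%N ->
  {ae mu, forall s, forall t, `|G j t s| <= D j s} /\
  forall psi, Psi psi -> mu.-integrable setT (EFin \o (fun s => D j s * psi s)).
Proof.
suff /choice[D HD] : forall j, exists Dj : T -> R, (j <= n)%N ->
    {ae mu, forall s, forall t, `|G j t s| <= Dj s} /\
    forall psi, Psi psi -> mu.-integrable setT (EFin \o (fun s => Dj s * psi s)).
  by exists D.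
elim=> [|j [Dj IH]]; first by exists M.
(* Beyond order [n] the claim is vacuous and [M] is a placeholder. *)
have [jn|] := boolP (j < n)%N; last by move=> /negP jn; exists M.
have [HD iD] := IH (ltnW jn).
have [del d0 Hd] := Gomega j.+1 jn _ ltr01.
(* With step [del / 2] the difference quotient of [G j] is at most
   [2 * Dj / (del / 2) = 4 / del * Dj], and it misses [G j.+1] by at most [omega j.+1]. *)
exists (fun s => (4 / del) * Dj s + omega j.+1 s) => _; split; last first.
  move=> psi Ppsi.
  have -> : (fun s => (4 / del * Dj s + omega j.+1 s) * psi s) =
            (fun s => 4 / del * (Dj s * psi s) + omega j.+1 s * psi s).
    by apply/funext => s; rewrite mulrDl mulrA.
  apply: (integrable_linear mu (4 / del) (fun s => Dj s * psi s)
    (fun s => omega j.+1 s * psi s)); [exact: iD|exact: iomega].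
apply: filterS2 HD Hd => s Ds Hs t.
have d20 : 0 < del / 2 by rewrite divr_gt0.
have tE : t + del / 2 - t = del / 2 by rewrite addrAC subrr add0r.
have td : `|t + del / 2 - t| < del.
  by rewrite tE ger0_norm ?(ltW d20)// ltr_pdivrMr// ltr_pMr// ltr1n.
have := linear_approx_le (G j ^~ s) (G j.+1 ^~ s) t _ del (Gder j jn s)
  (fun y => Hs y t) _ td.
rewrite /= tE mul1r (ger0_norm (ltW d20)) /=.
have := Ds t; have := Ds (t + del / 2).
move: (G j _ s) (G j t s) (G j.+1 t s) (Dj s) (omega j.+1 s) => a b c D w Ha Hb Hc.
have : `|c * (del / 2)| <= (4 / del * D + w) * (del / 2).
  rewrite (_ : (4 / del * D + w) * (del / 2) = D + D + w * (del / 2)); last by field; exact: lt0r_neq0.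
  have -> : c * (del / 2) = a - b - (a - b - c * (del / 2)) by ring.
  apply: (le_trans (ler_normB _ _)); apply: lerD Hc.
  by apply: (le_trans (ler_normB _ _)); exact: lerD.
by rewrite normrM (ger0_norm (ltW d20)) ler_pM2r.
Qed.

End kernel_bound.

(** Sequences make dominated convergence applicable, and the explicit rate keeps them in a ball
    around [v]. *)
Lemma seq_cvg_at {R : realType} {V W : normedModType R} (f : V -> W) (v : V) :
  (forall u_ : nat -> V, (forall m, `|v - u_ m| <= m.+1%:R^-1) ->
     f (u_ m) @[m --> \oo] --> f v) ->
  f x @[x --> v] --> f v.
Proof.
move=> H; apply/cvgrPdist_le => e e0; apply: contrapT => nH.
have /choice[u_ Hu] : forall m : nat, exists u : V,
    `|v - u| <= m.+1%:R^-1 /\ ~ (`|f v - f u| <= e).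
  move=> m; apply: contrapT => nu; apply: nH.
  have m0 : 0 < m.+1%:R^-1 :> R by rewrite invr_gt0.
  apply: filterS (nbhsx_ballx v _ m0) => x; rewrite -ball_normE /= => vx; apply: contrapT => nx; apply: nu; exists x.
  by split => //; exact: ltW.
have /cvgrPdist_le/(_ e e0)[m _ /(_ m (leqnn m))/=] :=
  H u_ (fun m => (Hu m).1).
exact: (Hu m).2.
Qed.

(** * Derivatives and sums of elements of the weighted space *)

Section Ctilde_elements.
Context {R : realType} {n : nat} (phi : weight R n).
Implicit Type h : R -> R.

Lemma tder_der_chain h : in_Ctilde n phi h -> der_chain n (tder phi h).
Proof. by move=> hin; have := Ctilde_der_chain phi (to_Ctilde phi h); rewrite to_CtildeE. Qed.

Lemma tder_cvg h j : in_Ctilde n phi h -> (j <= n)%N ->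
  cvg (tder phi h j t @[t --> +oo]) /\ cvg (tder phi h j t @[t --> -oo]).
Proof. by move=> hin jn; have [[_ _ +] _] := factor_tilde hin; exact. Qed.

Lemma tder0 h t : in_Ctilde n phi h -> tder phi h 0 t = h t / phi t.
Proof.
move=> hin; have [_ ->] := factor_tilde hin.
by rewrite mulrAC divff ?mul1r//; exact: lt0r_neq0 (weight_gt0 phi t).
Qed.

Lemma tder_continuous h j : in_Ctilde n phi h -> (j <= n)%N ->
  continuous (tder phi h j).
Proof.
move=> hin jn; have [[_ C _] _] := factor_tilde hin.
exact: Cn_continuous C jn.
Qed.

(** Relates the derivatives of [k * eta / phi], which exist by membership in the space, to the
    expression of (C1), where [k / phi] is differentiated before the factor [eta s] is applied. *)
Lemma tder_mulr h (c : R) j t : in_Ctilde n phi (fun t => h t * c) -> (j <= n)%N ->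
  tder phi (fun t => h t * c) j t = derive1n j (fun t => h t / phi t) t * c.
Proof.
move=> hin jn; have E t' : (tilde n phi (fun t => h t * c) \o EFin) t' = h t' * c / phi t'.
  exact: (tder0 _ t' hin).
(* For [c = 0] the function [h / phi] may fail to be differentiable, but both sides are zero;
   otherwise [c] can be divided out. *)
have [c0|c0] := eqVneq c 0.
  rewrite c0 mulr0 in hin E *.
  rewrite /tder (_ : _ \o _ = fun=> 0) ?derive1n_cst0//.
  by apply/funext => t'; rewrite E mulr0 mul0r.
have [[_ C _] _] := factor_tilde hin.
rewrite (_ : (fun t => h t / phi t) = fun t => c^-1 *
    (tilde n phi (fun t => h t * c) \o EFin) t + (fun=> 0) t).
  by rewrite (derive1n_linear c^-1 C (Cn0 n) jn) derive1n_cst0 addr0 mulrC mulrA divff// mul1r.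
by apply/funext => t'; rewrite E addr0 -mulrA mulrCA mulKf.
Qed.

Lemma in_Ctilde_add h1 h2 : in_Ctilde n phi h1 -> in_Ctilde n phi h2 ->
  in_Ctilde n phi (fun t => h1 t + h2 t).
Proof.
move=> h1in h2in; have := Ctilde_in phi (to_Ctilde phi h1 + to_Ctilde phi h2).
by rewrite -[X in in_Ctilde _ _ X]/(_ + _) /= !to_CtildeE.
Qed.

Lemma to_CtildeD h1 h2 : in_Ctilde n phi h1 -> in_Ctilde n phi h2 ->
  to_Ctilde phi (fun t => h1 t + h2 t) = to_Ctilde phi h1 + to_Ctilde phi h2.
Proof.
move=> h1in h2in; apply: val_inj => /=.
by rewrite -[LHS]/(_ : R -> R) to_CtildeE ?to_CtildeE//; exact: in_Ctilde_add.
Qed.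

End Ctilde_elements.

(** * The operator T *)

Section operator.
Context {R : realType} {n : nat} (phi : weight R n).
Variables (k : R -> R -> R) (eta : R -> R) (f : R -> R -> R).
Variables (omega : nat -> R -> R) (phir : R -> R -> R).

Hypothesis f_ge0 : forall s y : R, 0 <= f s y.
Hypothesis k_L1 : forall t, in_L1 (fun s => k t s * eta s).
Hypothesis k_space : forall s, in_Ctilde n phi (fun t => k t s * eta s).
Hypothesis k_omega : forall j, (j <= n)%N -> forall e : R, 0 < e ->
  exists2 d : R, 0 < d &
    forall t1 t2 : R, `|t1 - t2| < d -> \forall s \ae leb R,
      `|derive1n j (fun t => k t s / phi t) t1 * eta s
        - derive1n j (fun t => k t s / phi t) t2 * eta s| < e * omega j s.
Hypothesis f_meas : forall y : R, leb_measurable (fun t => f t y).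
Hypothesis f_cont : \forall t \ae leb R, continuous (f t).
Hypothesis f_phir : forall r : R, 0 < r -> in_L1 (phir r) /\
  forall y : R, - r <= y <= r -> \forall t \ae leb R, f t (y * phi t) <= phir r t.
Hypothesis omega_phir : forall r : R, 0 < r -> forall j, (j <= n)%N ->
  in_L1 (fun s => omega j s * phir r s).
Hypothesis M_phir : forall r : R, 0 < r ->
  in_L1 (fun s => sup (range (fun t => `|k t s * eta s / phi t|)) * phir r s).

Definition ker j t s := tder phi (fun t => k t s * eta s) j t.

Lemma ker_is_derive j : (j < n)%N -> forall s (t : R),
  is_derive t 1 (ker j ^~ s) (ker j.+1 t s).
Proof. by move=> jn s t; have [D _] := tder_der_chain phi _ (k_space s); exact: D. Qed.

Lemma ker_cvg j : (j <= n)%N -> forall s,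
  cvg (ker j t s @[t --> +oo]) /\ cvg (ker j t s @[t --> -oo]).
Proof. by move=> jn s; exact: tder_cvg (k_space s) jn. Qed.

(** Order zero comes from the integrability in (C1); each further order is a derivative in [t] of a
    measurable family. *)
Lemma ker_measurable j : (j <= n)%N -> forall t, leb_measurable (ker j t).
Proof.
elim: j => [_ t|j IH jn].
  have -> : ker 0 t = fun s => k t s * eta s * (phi t)^-1.
    by apply/funext => s; exact: tder0.
  exact: (measurable_funM (integrable_measurable (leb R) _ (k_L1 t))
    (measurable_cst (phi t)^-1)).
exact: (measurable_fun_is_derive (T := lebT R) (ker j) (ker j.+1)
  (ker_is_derive j jn) (IH (ltnW jn))).
Qed.

(** In [k_omega] the null set depends on [t1] and [t2]. Restricting to rational pairs leaves one
    null set, and continuity of the kernel in [t] extends the bound to all pairs. *)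
Lemma ker_omega j : (j <= n)%N -> forall e : R, 0 < e ->
  exists2 d : R, 0 < d & {ae leb R, forall s, forall t1 t2, `|t1 - t2| < d ->
    `|ker j t1 s - ker j t2 s| <= e * omega j s}.
Proof.
move=> jn e e0; have [d d0 Hd] := k_omega j jn e e0; exists d => //.
pose q (i : nat * int) : R := i.2%:~R / i.1.+1%:R.
have Hq : {ae leb R, forall s, forall i : (nat * int) * (nat * int),
    `|q i.1 - q i.2| < d -> `|ker j (q i.1) s - ker j (q i.2) s| <= e * omega j s}.
  apply: (ae_forall_countable (leb R)) => i.
  have [qd|nqd] := pselect (`|q i.1 - q i.2| < d); last by apply: aeW => s /nqd.
  apply: filterS (Hd _ _ qd) => s /ltW Hs _.
  by rewrite /ker !tder_mulr.
apply: filterS Hq => s Hs t1 t2 td.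
pose a (t : R) (m : nat) := q (m, Num.floor (m.+1%:R * t)).
have at_ t : a t m @[m --> \oo] --> t by exact: floor_approx_cvg.
have kc t : ker j (a t m) s @[m --> \oo] --> ker j t s.
  exact: cvg_comp (at_ t) (tder_continuous phi _ j (k_space s) jn t).
apply: (@cvgr_to_le _ \oo _ _ (fun m => `|ker j (a t1 m) s - ker j (a t2 m) s|)).
  by apply: cvg_norm; apply: cvgB; exact: kc.
(* Since [|t1 - t2| < d] is strict, the approximating pairs satisfy it eventually. *)
have ad : `|a t1 m - a t2 m| @[m --> \oo] --> `|t1 - t2|.
  by apply: cvg_norm; apply: cvgB; exact: at_.
have : \forall m \near \oo, `|a t1 m - a t2 m| < d by exact: cvgr_lt ad _ td.
by apply: filterS => m am; exact: (Hs ((m, _), (m, _))).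
Qed.

Lemma ker_sup t s : `|ker 0 t s| <= sup (range (fun t => `|k t s * eta s / phi t|)).
Proof.
have kE : (fun t => `|k t s * eta s / phi t|) = (fun t => `|ker 0 t s|).
  by apply/funext => t'; rewrite /ker tder0.
rewrite kE; apply: ub_le_sup; last by exists t.
by have [C _] := factor_tilde (k_space s); have [] := Cbar_has_sup C (leq0n n).
Qed.

Lemma ker_bound : exists D : nat -> R -> R, forall j, (j <= n)%N ->
  {ae leb R, forall s, forall t, `|ker j t s| <= D j s} /\
  forall r, 0 < r -> in_L1 (fun s => D j s * phir r s).
Proof.
have GM : {ae leb R, forall s, forall t,
    `|ker 0 t s| <= sup (range (fun t => `|k t s * eta s / phi t|))}.
  by apply: aeW => s t; exact: ker_sup.
(* All the [phir r] form the set of densities, so a single [D] serves every radius. *)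
have [_ [r r0 <-]|_ [r r0 <-] j jn|D HD] := kernel_bound (leb R) n ker omega
  (fun s => sup (range (fun t => `|k t s * eta s / phi t|)))
  (phir @` [set r | 0 < r]) ker_is_derive ker_omega GM.
- exact: M_phir.
- exact: omega_phir.
exists D => j jn; have [H1 H2] := HD j jn; split; first exact: H1.
by move=> r r0; apply: H2; exists r.
Qed.

(** As in [ker_omega], rational values of [y] and continuity of [f s] give one null set for all [y].
    The radius grows to [r + 1] because approximants of [y] may leave [[-r, r]]. *)
Lemma f_le_phir r : 0 <= r -> {ae leb R, forall s, forall y, `|y| <= r ->
  f s (y * phi s) <= phir (r + 1) s}.
Proof.
move=> r0; have r1 : 0 < r + 1 by rewrite ltr_wpDl.
have [_ fr] := f_phir _ r1.
pose q (i : nat * int) : R := i.2%:~R / i.1.+1%:R.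
have Hq : {ae leb R, forall s, forall i : nat * int, `|q i| < r + 1 ->
    f s (q i * phi s) <= phir (r + 1) s}.
  apply: (ae_forall_countable (leb R)) => i.
  have [qr|nqr] := pselect (`|q i| < r + 1); last by apply: aeW => s /nqr.
  by apply: filterS (fr (q i) _) => [s //|]; rewrite -ler_norml ltW.
apply: filterS2 Hq f_cont => s Hs fc y yr.
pose a (m : nat) := q (m, Num.floor (m.+1%:R * y)).
have ay : a m @[m --> \oo] --> y by exact: floor_approx_cvg.
apply: (@cvgr_to_le _ \oo _ _ (fun m => f s (a m * phi s))).
  apply: (cvg_comp _ (f s) _ (fc _)).
  by apply: cvgM; [exact: ay|exact: cvg_cst].
have ay' : `|a m| @[m --> \oo] --> `|y| by exact: cvg_norm.
have yr1 : `|y| < r + 1 by apply: le_lt_trans yr _; rewrite ltrDl.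
have : \forall m \near \oo, `|a m| < r + 1 by exact: cvgr_lt ay' _ yr1.
by apply: filterS => m am; exact: Hs.
Qed.

Definition nemytskii (u : R -> R) : R -> R := fun s => f s (u s).

Lemma nemytskii_measurable (u : Ctilde phi) : leb_measurable (nemytskii u).
Proof.
apply: leb_measurable_superposition => //.
by apply: continuous_leb_measurable; have [C _] := Ctilde_in phi u; exact: Cn_continuous C (leq0n n).
Qed.

Lemma nemytskii_le (u : Ctilde phi) r : `|u| <= r ->
  {ae leb R, forall s, `|nemytskii u s| <= phir (r + 1) s}.
Proof.
move=> ur; have r0 := le_trans (normr_ge0 u) ur.
apply: filterS (f_le_phir _ r0) => s Hs; rewrite ger0_norm ?f_ge0//.
rewrite /nemytskii CtildeE mulrC; apply: Hs; apply: le_trans ur.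
exact: normr_tder_le.
Qed.

(** * The integral part of the operator *)

Section bounded_kernel.
Variable D : nat -> R -> R.
Hypothesis kerD : forall j, (j <= n)%N ->
  {ae leb R, forall s, forall t, `|ker j t s| <= D j s}.
Hypothesis D_phir : forall r, 0 < r -> forall j, (j <= n)%N ->
  in_L1 (fun s => D j s * phir r s).

Definition int_part (u : R -> R) t : R := \int[leb R]_s (k t s * eta s * f s (u s)).

Let C r j : R := \int[leb R]_s (D j s * phir (r + 1) s).
Let W r := osc (leb R) ker (phir (r + 1)).

Let r1_gt0 r : 0 <= r -> 0 < r + 1 :> R.
Proof. by move=> r0; rewrite ltr_wpDl. Qed.

(** The value [y = 0] gives [phir (r + 1) s] the lower bound [f s 0], which is nonnegative. *)
Let phir_ge0 r : 0 <= r -> {ae leb R, forall s, 0 <= phir (r + 1) s}.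
Proof.
move=> r0; apply: filterS (f_le_phir _ r0) => s /(_ 0).
by rewrite normr0 => /(_ r0); apply: le_trans; exact: f_ge0.
Qed.

Lemma osc_ker_modulus r j : 0 <= r -> (j <= n)%N -> end_modulus (W r j).
Proof.
move=> r0 jn; have r1 := r1_gt0 _ r0.
exact: (osc_end_modulus (leb R) n ker omega D (phir (r + 1)) ker_cvg
  ker_measurable ker_omega kerD (f_phir _ r1).1 (phir_ge0 _ r0)
  (omega_phir _ r1) (D_phir _ r1) j jn).
Qed.

Lemma kint_ker_osc (u : Ctilde phi) r j t1 t2 : `|u| <= r -> (j <= n)%N ->
  `|kint (leb R) ker (nemytskii u) j t1 - kint (leb R) ker (nemytskii u) j t2|
    <= W r j t1 t2.
Proof.
move=> ur jn; have r0 := le_trans (normr_ge0 u) ur; have r1 := r1_gt0 _ r0.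
exact: (kint_osc (leb R) n ker D (phir (r + 1)) ker_measurable kerD
  (f_phir _ r1).1 (phir_ge0 _ r0) (D_phir _ r1) (nemytskii u)
  (nemytskii_measurable u) (nemytskii_le u r ur) j t1 t2 jn).
Qed.

Lemma int_partE (u : Ctilde phi) :
  int_part u = fun t => phi t * kint (leb R) ker (nemytskii u) 0%N t.
Proof.
apply/funext => t; have r1 := r1_gt0 _ (normr_ge0 u).
have iK := integrable_kernel (leb R) n ker D (phir (`|u| + 1)) ker_measurable
  kerD (D_phir _ r1) (nemytskii u) (nemytskii_measurable u)
  (nemytskii_le u _ (lexx _)) 0%N t (leq0n n).
rewrite /kint -(RintegralZl (phi t) measurableT iK).
congr (Rintegral _ _ _); apply/funext => s; rewrite /ker tder0//.
by rewrite mulrA mulrCA divff ?mulr1// lt0r_neq0// weight_gt0.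
Qed.

Lemma int_part_Ctilde (u : Ctilde phi) : in_Ctilde n phi (int_part u) /\
  forall j, (j <= n)%N ->
    tder phi (int_part u) j = kint (leb R) ker (nemytskii u) j.
Proof.
have r1 := r1_gt0 _ (normr_ge0 u).
rewrite int_partE; apply: (der_chain_in_Ctilde phi (W `|u|)).
- by move=> j; apply: osc_ker_modulus.
- exact: (kint_der_chain (leb R) n ker omega D (phir (`|u| + 1)) ker_is_derive
    ker_cvg ker_measurable ker_omega kerD (f_phir _ r1).1
    (phir_ge0 _ (normr_ge0 u)) (omega_phir _ r1) (D_phir _ r1) (nemytskii u)
    (nemytskii_measurable u) (nemytskii_le u _ (lexx _))).
- by move=> j jn t1 t2; apply: kint_ker_osc.
Qed.

(** Bounds and moduli depend on [r] alone, so the image of a whole ball lies in one compact set. *)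
Lemma int_part_equi (u : Ctilde phi) r : `|u| <= r ->
  equi_set phi (C r) (W r) (to_Ctilde phi (int_part u)).
Proof.
move=> ur j jn; have r1 := r1_gt0 _ (le_trans (normr_ge0 u) ur).
have [Sin SE] := int_part_Ctilde u; rewrite to_CtildeE// SE//; split.
  move=> t; exact: (normr_kint_le (leb R) n ker D (phir (r + 1)) ker_measurable
    kerD (D_phir _ r1) (nemytskii u) (nemytskii_measurable u)
    (nemytskii_le u r ur) j t jn).
by move=> t1 t2; exact: kint_ker_osc.
Qed.

Lemma int_part_continuous :
  continuous (fun u : Ctilde phi => to_Ctilde phi (int_part u)).
Proof.
move=> u; apply: seq_cvg_at => u_ Hu.
(* The rate [m.+1%:R^-1] is at most one, so the whole sequence stays in this ball and the images
   share one [equi_set]. *)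
pose r := `|u| + 1; have r0 : 0 <= r by rewrite addr_ge0.
have ur : `|u| <= r by rewrite lerDl.
have u_r m : `|u_ m| <= r.
  rewrite -(subKr u (u_ m)); apply: (le_trans (ler_normB _ _)); rewrite lerD2l.
  by apply: (le_trans (Hu m)); rewrite invf_le1// ler1n.
apply: (equi_set_cvg phi \oo (C r) (W r)).
- by move=> j; exact: osc_ker_modulus.
- by apply: nearW => m; exact: int_part_equi.
- exact: int_part_equi.
move=> j jn t; have r1 := r1_gt0 _ r0.
have E (v : Ctilde phi) : tder phi (to_Ctilde phi (int_part v)) j t =
    kint (leb R) ker (nemytskii v) j t.
  have [Sin SE] := int_part_Ctilde v; by rewrite to_CtildeE// SE.
under eq_fun do rewrite E.
rewrite E.
apply: (kint_cvg (leb R) n ker D (phir (r + 1)) ker_measurable kerD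
  (D_phir _ r1) (fun m => nemytskii (u_ m)) (nemytskii u) j t jn
  (fun m => nemytskii_measurable (u_ m)) (nemytskii_measurable u)
  (fun m => nemytskii_le (u_ m) r (u_r m)) (nemytskii_le u r ur)).
(* Norm convergence of [u_] gives convergence of [u_ m s] at each [s], and continuity of [f s]
   carries it to the densities. *)
apply: filterS f_cont => s fc; apply: (cvg_comp _ (f s) _ (fc _)).
rewrite CtildeE.
have -> : (fun m => u_ m s) = (fun m => phi s * tder phi (u_ m) 0 s).
  by apply/funext => m; exact: CtildeE.
apply: cvgM; first exact: cvg_cst.
apply/cvgrPdist_le => e e0; near=> m.
rewrite -tderB//; apply: (le_trans (normr_tder_le _ _ _ _ _)) => //.
apply: (le_trans (Hu m)); apply: ltW.
by near: m; exact: (near_infty_natSinv_lt (PosNum e0)).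
Unshelve. all: by end_near. Qed.

Lemma int_part_precompact r : 0 <= r -> exists2 K : set (Ctilde phi),
  compact K & forall u : Ctilde phi, `|u| <= r -> K (to_Ctilde phi (int_part u)).
Proof.
move=> r0; exists (equi_set phi (C r) (W r)); last by move=> u; exact: int_part_equi.
by apply: compact_equi_set => j; exact: osc_ker_modulus.
Qed.

End bounded_kernel.

End operator.

Theorem theorem4p1 (R : realType) (n : nat) (phi : weight R n)
  (k : R -> R -> R) (p eta : R -> R) (f : R -> R -> R)
  (f_ge0 : forall s y : R, 0 <= f s y)
  (alpha : Ctilde phi -> R)
  (alpha_cont : continuous alpha)
  (alphaD : forall u v : Ctilde phi, alpha u + alpha v <= alpha (u + v))
  (alphaZ : forall (l : R) (u : Ctilde phi), 0 <= l -> l * alpha u <= alpha (l *: u))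
  (alpha_eq0 : forall u : Ctilde phi, 0 <= alpha u -> 0 <= alpha (- u) -> u = 0)
  (omega : nat -> R -> R) (phir : R -> R -> R)
  (* C1 *)
  (C1_L1 : forall t j, (j <= n)%N ->
    in_L1 (fun s => derive1n j (fun t' => k t' s) t * eta s))
  (C1_space : forall s, in_Ctilde n phi (fun t => k t s * eta s))
  (C1_omega : forall j, (j <= n)%N -> leb_measurable (omega j) /\
    forall e : R, 0 < e -> exists2 d : R, 0 < d &
      forall t1 t2 : R, `|t1 - t2| < d -> \forall s \ae leb R,
        `|derive1n j (fun t => k t s / phi t) t1 * eta s
          - derive1n j (fun t => k t s / phi t) t2 * eta s| < e * omega j s)
  (* C2 *)
  (C2_meas : forall y : R, leb_measurable (fun t => f t y))
  (C2_cont : \forall t \ae leb R, continuous (f t))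
  (C2_phir : forall r : R, 0 < r -> in_L1 (phir r) /\
    forall y : R, - r <= y <= r ->
      \forall t \ae leb R, f t (y * phi t) <= phir r t)
  (* C3 *)
  (C3_Linfty : forall r : R, 0 < r -> forall j l, (l <= j)%N -> (j <= n)%N ->
    in_Linfty (fun t =>
      (derive1n (j - l)%N (fun t' => (phi t')^-1) t)%:E *
      \int[leb R]_s
        (`|derive1n l (fun t' => k t' s) t * eta s| * phir r s)%:E)%E)
  (C3_omega : forall r : R, 0 < r -> forall j, (j <= n)%N ->
    in_L1 (fun s => omega j s * phir r s))
  (C3_zp : forall r : R, 0 < r ->
    in_L1 (fun s => `|lim (k t s * eta s / phi t @[t --> +oo])| * phir r s))
  (C3_zm : forall r : R, 0 < r ->
    in_L1 (fun s => `|lim (k t s * eta s / phi t @[t --> -oo])| * phir r s))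
  (C3_M : forall r : R, 0 < r ->
    in_L1 (fun s => sup (range (fun t => `|k t s * eta s / phi t|)) * phir r s))
  (* C4 *)
  (C4 : in_Ctilde n phi p)
  (* C5 *)
  (C5_k : \forall s \ae leb R,
    0 <= alpha (to_Ctilde phi (fun t => k t s * eta s)))
  (C5_p : 0 <= alpha (to_Ctilde phi p))
  (* C6 *)
  (C6 : forall u : Ctilde phi, cone alpha u ->
    (\int[leb R]_s
       (alpha (to_Ctilde phi (fun t => k t s * eta s)) * f s (u s))%:E
     + (alpha (to_Ctilde phi p))%:E
     <= (alpha (to_Ctilde phi (integral_op p k eta f u)))%:E)%E) :
  let T (u : Ctilde phi) : Ctilde phi :=
    to_Ctilde phi (integral_op p k eta f u) in
  [/\ forall u : Ctilde phi, in_Ctilde n phi (integral_op p k eta f u),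
      continuous T,
      forall B : set (Ctilde phi), bounded_set B -> precompact (T @` B) &
      T @` cone alpha `<=` cone alpha].
Proof.
have k_L1 t : in_L1 (fun s => k t s * eta s) := C1_L1 t 0%N (leq0n n).
have k_omega j (jn : (j <= n)%N) := (C1_omega j jn).2.
have [D HD] := ker_bound phi k eta omega phir C1_space k_omega C3_omega C3_M.
have kerD j (jn : (j <= n)%N) := (HD j jn).1.
have D_phir r (r0 : 0 < r) j (jn : (j <= n)%N) := (HD j jn).2 r r0.
pose S := int_part k eta f.
have S_in (u : Ctilde phi) : in_Ctilde n phi (S u) :=
  (int_part_Ctilde phi k eta f omega phir f_ge0 k_L1 C1_space k_omega C2_meas
    C2_cont C2_phir C3_omega D kerD D_phir u).1.
(* [T] is the integral part translated by [p], so membership, continuity and compactness transfer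
   from [S]. *)
move=> T; have TE : T = fun u => to_Ctilde phi p + to_Ctilde phi (S u).
  by apply/funext => u; exact: (to_CtildeD phi p (S u) C4 (S_in u)).
split.
- by move=> u; exact: (in_Ctilde_add phi p (S u) C4 (S_in u)).
- rewrite TE => u; exact: (cvgD (cvg_cst _) (int_part_continuous phi k eta f omega
    phir f_ge0 k_L1 C1_space k_omega C2_meas C2_cont C2_phir C3_omega D kerD D_phir u)).
(* [HM] applies to bounds strictly above [M]; the maximum with zero makes the radius nonnegative. *)
- move=> B [M [_ HM]]; pose r := Num.max M 0 + 1.
  have r0 : 0 <= r by rewrite addr_ge0// le_max lexx orbT.
  have Mr : M < r by rewrite (@le_lt_trans _ _ (Num.max M 0)) ?le_max ?lexx// ltrDl.
  have Br u : B u -> `|u| <= r by exact: HM.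
  have [K cK SK] := int_part_precompact phi k eta f omega phir f_ge0 k_L1
    C1_space k_omega C2_meas C2_cont C2_phir C3_omega D kerD D_phir r r0.
  apply: (@precompact_subset _ _ ((fun v => to_Ctilde phi p + v) @` K)).
    move=> _ [u Bu <-]; rewrite TE; exists (to_Ctilde phi (S u)) => //.
    by apply: SK; exact: Br.
  apply: compact_precompact; first exact: norm_hausdorff.
  apply: continuous_compact cK; apply: continuous_subspaceT => v.
  by apply: (@cvgD _ _ _ (nbhs v) _ (fun=> to_Ctilde phi p) (fun x => x) _ v);
    [exact: cvg_cst|exact: cvg_id].
(* By (C6) it suffices that the integral and [alpha] of [p] are nonnegative. The integrand is so
   almost everywhere by [C5_k] and [f_ge0], and [complete_integral_ge0] applies to it although its
   measurability is not known. *)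
- move=> _ [u uK <-]; rewrite /cone /= -lee_fin; apply: le_trans (C6 u uK).
  apply: adde_ge0; last by rewrite lee_fin.
  apply: complete_integral_ge0; first exact: completed_lebesgue_measure_is_complete.
  by apply: filterS C5_k => s as0; rewrite lee_fin; exact: mulr_ge0.
Qed.
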